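(* With the operation $(f\times g)(x)=\int_G g(y^{-1}x)f(y)\,dy$ for $f\in\mathcal H(G,K)$, $g\in\mathcal H(G,H,K)$, $x\in G$, the space $\mathcal H(G,H,K)$ is a left $\mathcal H(G,K)$-module.
   Context: $k$ is a finite field with $\mathrm{char}(k)\ne2$; $G=\mathrm{GL}_n(k((z)))$, $K=\mathrm{GL}_n(k[[z]])$, $H=\mathrm{GL}_n(k((z^2)))$; $dy$ is the Haar measure on $G$ with $K$ of measure $1$. $\mathcal H(G,K)$ is the spherical Hecke algebra: the algebra of complex-valued continuous compactly supported $K$-bi-invariant functions on $G$ under convolution $(f_1f_2)(x)=\int_G f_1(xy)f_2(y^{-1})\,dy$, with identity the characteristic function of $K$. Every double coset in $K\backslash G/H$ contains a block diagonal matrix with blocks among $(1)$, $(z)$, $\begin{pmatrix}1&z\\0&z^i\end{pmatrix}$ ($i>1$), unique when the blocks are put in nondecreasing order of valuation. These normal forms are indexed by partitions $\lambda$ of length $n$ (the block $(1)$ contributes $0$, $(z)$ contributes $1$, $\begin{pmatrix}1&z\\0&z^i\end{pmatrix}$ contributes $i$ and $0$) and denoted $\Pi^\lambda$; $d_\lambda$ is the characteristic function of $K\Pi^\lambda H$. The Hecke module $\mathcal H(G,H,K)$ is the complex vector space of functions on $G$ that are linear combinations of the $d_\lambda$; the $d_\lambda$ form a $\mathbb C$-basis. *)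

(* Defs.v *)
From HB Require Import structures.
From mathcomp Require Import all_boot all_order all_algebra.
From mathcomp Require Import fraction zify.
From mathcomp Require Import complex.
From mathcomp Require Import all_classical all_reals all_analysis.

Set Implicit Arguments.
Unset Strict Implicit.
Unset Printing Implicit Defensive.

Import Order.TTheory GRing.Theory Num.Theory.
Import numFieldNormedType.Exports.

Local Open Scope classical_set_scope.
Local Open Scope ring_scope.

Record pseries (k : fieldType) := PSeries { pscoef : nat -> k }.

HB.instance Definition _ (k : fieldType) := gen_eqMixin (pseries k).
HB.instance Definition _ (k : fieldType) := gen_choiceMixin (pseries k).

Section PowerSeries.
Variable k : fieldType.
Implicit Types a b c : pseries k.

Definition ps0 : pseries k := PSeries (fun=> 0).
Definition ps1 : pseries k := PSeries (fun i => (i == 0)%:R).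
Definition psopp a := PSeries (fun i => - pscoef a i).
Definition psadd a b := PSeries (fun i => pscoef a i + pscoef b i).
Definition psmul a b :=
  PSeries (fun i => \sum_(j < i.+1) pscoef a j * pscoef b (i - j)).

Lemma pseriesP a b : pscoef a =1 pscoef b -> a = b.
Proof. by case: a b => [a] [b] /= /funext ->. Qed.

Fact psaddA : associative psadd.
Proof. by move=> a b c; apply: pseriesP => i /=; rewrite addrA. Qed.
Fact psaddC : commutative psadd.
Proof. by move=> a b; apply: pseriesP => i /=; rewrite addrC. Qed.
Fact psadd0 : left_id ps0 psadd.
Proof. by move=> a; apply: pseriesP => i /=; rewrite add0r. Qed.
Fact psaddN : left_inverse ps0 psopp psadd.
Proof. by move=> a; apply: pseriesP => i /=; rewrite addNr. Qed.

HB.instance Definition _ :=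
  GRing.isZmodule.Build (pseries k) psaddA psaddC psadd0 psaddN.

Let trunc m a : {poly k} := \poly_(i < m) pscoef a i.

Let psmulE m a b i : (i < m)%N ->
  pscoef (psmul a b) i = (trunc m a * trunc m b)`_i.
Proof.
move=> im; rewrite coefM /=; apply: eq_bigr => j _; rewrite !coef_poly.
have ji : (j <= i)%N by rewrite -ltnS.
by rewrite (leq_ltn_trans ji im) (leq_ltn_trans (leq_subr j i) im).
Qed.

Let trunc_mul m a b i : (i < m)%N ->
  (trunc m (psmul a b))`_i = (trunc m a * trunc m b)`_i.
Proof. by move=> im; rewrite coef_poly im (psmulE _ _ im). Qed.

Fact psmulA : associative psmul.
Proof.
move=> a b c; apply: pseriesP => i; rewrite !(psmulE _ _ (ltnSn i)).
transitivity ((trunc i.+1 a * (trunc i.+1 b * trunc i.+1 c))`_i).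
  rewrite !coefM; apply: eq_bigr => j _.
  by rewrite trunc_mul // ltnS leq_subr.
rewrite mulrA !coefM; apply: eq_bigr => j _.
by rewrite trunc_mul.
Qed.
Fact psmulC : commutative psmul.
Proof.
by move=> a b; apply: pseriesP => i; rewrite !(psmulE _ _ (ltnSn i)) mulrC.
Qed.
Fact psmul1 : left_id ps1 psmul.
Proof.
move=> a; apply: pseriesP => i /=.
rewrite big_ord_recl /= mul1r subn0 big1 ?addr0// => j _.
by rewrite mul0r.
Qed.
Fact psmulDl : left_distributive psmul psadd.
Proof.
move=> a b c; apply: pseriesP => i /=.
by rewrite -big_split; apply: eq_bigr => j _; rewrite mulrDl.
Qed.
Fact ps1_neq0 : ps1 != ps0.
Proof.
apply/eqP => /(congr1 (fun a => pscoef a 0)) /= /eqP.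
by rewrite oner_eq0.
Qed.

HB.instance Definition _ := GRing.Zmodule_isComNzRing.Build (pseries k)
  psmulA psmulC psmul1 psmulDl ps1_neq0.

Definition psunit : pred (pseries k) := fun a => `[< exists b, b * a = 1 >].
Definition psinv a : pseries k :=
  if pselect (exists b, b * a = 1) is left e then projT1 (cid e) else a.

Fact psmulV : {in psunit, left_inverse 1 psinv *%R}.
Proof.
move=> a /asboolP ua; rewrite /psinv; case: pselect => // e.
exact: projT2 (cid e).
Qed.
Fact psunitP a b : b * a = 1 -> psunit a.
Proof. by move=> ba; apply/asboolP; exists b. Qed.
Fact psinv_out : {in [predC psunit], psinv =1 id}.
Proof.
move=> a /negP ua; rewrite /psinv; case: pselect => // e.
by case: ua; apply/asboolP.
Qed.

HB.instance Definition _ := GRing.ComNzRing_hasMulInverse.Build (pseries k)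
  psmulV psunitP psinv_out.

Let ps_neq0 a : a != 0 ->
  exists m, pscoef a m != 0 /\ forall i, (i < m)%N -> pscoef a i = 0.
Proof.
move=> a0; have ex : exists m, pscoef a m != 0.
  apply: contrapT => H; case/eqP: a0; apply: pseriesP => i /=.
  by apply: contrapT => /eqP ai; apply: H; exists i.
exists (ex_minn ex); case: ex_minnP => m am mmin; split=> // i im.
by apply: contraTeq im => ai; rewrite -leqNgt mmin.
Qed.

Fact psmulf_eq0 a b : a * b = 0 -> (a == 0) || (b == 0).
Proof.
move=> ab0; apply: contrapT => /negP; rewrite negb_or => /andP[].
move=> /ps_neq0[m [am a_lt]] /ps_neq0[p [bp b_lt]].
have : pscoef (a * b) (m + p) = 0 by rewrite ab0.
have mS : (m < (m + p).+1)%N by rewrite ltnS leq_addr.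
rewrite /= (bigD1 (Ordinal mS)) //= addKn big1 ?addr0 => [|j jm].
  by move/eqP; rewrite mulf_eq0 (negPf am) (negPf bp).
case: (ltngtP j m) => [jlt|jgt|jeq].
- by rewrite a_lt ?mul0r.
- by rewrite [X in _ * X]b_lt ?mulr0// ltn_subLR ?ltn_add2r // -ltnS.
- by case/eqP: jm; apply: val_inj.
Qed.

HB.instance Definition _ :=
  GRing.ComUnitRing_isIntegral.Build (pseries k) psmulf_eq0.

Definition psX : pseries k := PSeries (fun i => (i == 1)%:R).

End PowerSeries.

(** $k((z))$ as the fraction field of $k[[z]]$ *)
Definition laurent (k : fieldType) : Type := {fraction pseries k}.

HB.instance Definition _ (k : fieldType) :=
  GRing.Field.on (laurent k).

Section Laurent.
Variable k : fieldType.

Definition lz : laurent k := tofrac (psX k).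

Definition laurent_int : set (laurent k) := range (@tofrac (pseries k)).

(** $k((z^2))$, the fraction field of $k[[z^2]]$ *)
Definition even_pseries : set (pseries k) :=
  [set a | forall i, odd i -> pscoef a i = 0].
Definition laurent_sq : set (laurent k) :=
  [set x | exists a b, [/\ even_pseries a, even_pseries b, b != 0
                         & x = tofrac a / tofrac b]].

(** The cosets $x + z^m k[[z]]$, $m \in \mathbb{N}$, form a basis of
    neighbourhoods of $x$. *)
Definition laurent_open : set_system (laurent k) :=
  [set U | forall x, U x ->
     exists m : nat, forall a, laurent_int a -> U (x + lz ^+ m * a)].

Let lz_int m a : laurent_int a -> laurent_int (lz ^+ m * a).
Proof.
by move=> [b _ <-]; exists (psX k ^+ m * b) => //; rewrite rmorphM rmorphXn.
Qed.

Fact laurent_openT : laurent_open setT.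
Proof. by move=> x _; exists 0%N. Qed.
Fact laurent_openI : setI_closed laurent_open.
Proof.
move=> A B oA oB x [Ax Bx].
have [m Am] := oA _ Ax; have [p Bp] := oB _ Bx.
exists (m + p)%N => a ia; split.
  by rewrite exprD -mulrA; apply: Am; exact: lz_int.
by rewrite addnC exprD -mulrA; apply: Bp; exact: lz_int.
Qed.
Fact laurent_open_bigU (I : Type) (f : I -> set (laurent k)) :
  (forall i, laurent_open (f i)) -> laurent_open (\bigcup_i f i).
Proof.
move=> of_ x [i _ fx]; have [m fm] := of_ _ _ fx.
by exists m => a ia; exists i => //; exact: fm.
Qed.

End Laurent.

HB.instance Definition _ (k : fieldType) :=
  isOpenTopological.Build (laurent k)
    (@laurent_openT k) (@laurent_openI k) (@laurent_open_bigU k).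

Record GLn (k : fieldType) (n : nat) := MkGLn {
  GLmx :> 'M[laurent k]_n;
  GLmx_unit : GLmx \in unitmx }.

HB.instance Definition _ (k : fieldType) (n : nat) :=
  [isSub for @GLmx k n].
HB.instance Definition _ (k : fieldType) (n : nat) :=
  [Choice of GLn k n by <:].

Section GLnGroup.
Variables (k : fieldType) (n : nat).
Implicit Types g h : GLn k n.

Definition GL1 : GLn k n := MkGLn (unitmx1 (laurent k) n).
Fact GLmul_unit g h : GLmx g *m GLmx h \in unitmx.
Proof. by rewrite unitmx_mul !GLmx_unit. Qed.
Definition GLmul g h : GLn k n := MkGLn (GLmul_unit g h).
Fact GLinv_unit g : invmx (GLmx g) \in unitmx.
Proof. by rewrite unitmx_inv GLmx_unit. Qed.
Definition GLinv g : GLn k n := MkGLn (GLinv_unit g).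

Fact GLmulA : associative GLmul.
Proof. by move=> f g h; apply: val_inj; rewrite /= mulmxA. Qed.
Fact GLmul1g : left_id GL1 GLmul.
Proof. by move=> g; apply: val_inj; rewrite /= mul1mx. Qed.
Fact GLmulg1 : right_id GL1 GLmul.
Proof. by move=> g; apply: val_inj; rewrite /= mulmx1. Qed.
Fact GLmulVg : left_inverse GL1 GLinv GLmul.
Proof. by move=> g; apply: val_inj; rewrite /= mulVmx ?GLmx_unit. Qed.
Fact GLmulgV : right_inverse GL1 GLinv GLmul.
Proof. by move=> g; apply: val_inj; rewrite /= mulmxV ?GLmx_unit. Qed.

HB.instance Definition _ :=
  isGroup.Build (GLn k n) GLmulA GLmul1g GLmulg1 GLmulVg GLmulgV.

HB.instance Definition _ := isPointed.Build (GLn k n) GL1.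

(** The topology induced by the inclusion in the space of matrices
    (inversion in [laurent k] being continuous, this is the group topology). *)
HB.instance Definition _ := Topological.copy (GLn k n)
  (initial_topology (@GLmx k n : GLn k n -> 'M[laurent k]_n)).

(** $K = GL_n(k[[z]])$ and $H = GL_n(k((z^2)))$: the inverse must have its
    entries in the subring as well. *)
Definition GLint : set (GLn k n) :=
  [set g : GLn k n | forall i j, laurent_int (g i j) /\ laurent_int ((g^-1)%g i j)].
Definition GLsq : set (GLn k n) :=
  [set g : GLn k n | forall i j, laurent_sq (g i j) /\ laurent_sq ((g^-1)%g i j)].

End GLnGroup.

Section NormalForms.
Variable k : fieldType.
Local Notation z := (lz k).

(** The block with label [i] has valuation [i]. *)
Definition nf_block_size (i : nat) : nat := if i is _.+2 then 2 else 1.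

Definition nf_block (i : nat) : 'M[laurent k]_(nf_block_size i) :=
  match i return 'M[laurent k]_(nf_block_size i) with
  | 0%N => 1%:M
  | 1%N => z%:M
  | j.+2 => block_mx (1%:M : 'M[laurent k]_1) z%:M
                     0 ((z ^+ j.+2)%:M : 'M[laurent k]_1)
  end.

Definition nf_size (s : seq nat) : nat := sumn (map nf_block_size s).

Fixpoint nf_blockdiag (s : seq nat) : 'M[laurent k]_(nf_size s) :=
  match s return 'M[laurent k]_(nf_size s) with
  | [::] => 0
  | i :: s' => block_mx (nf_block i) 0 0 (nf_blockdiag s')
  end.

(** A partition of length [n] (zero parts allowed) coming from a list of blocks:
    each 2 x 2 block contributes a part larger than 1 together with a 0, so there
    must be at least as many parts equal to 0 as parts larger than 1. *)
Record nf_index (n : nat) := NfIndex {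
  nf_parts :> n.-tuple nat;
  nf_sorted : sorted geq nf_parts;
  nf_zeros : (count (ltn 1) nf_parts <= count_mem 0%N nf_parts)%N }.

(** The labels of the blocks of the normal form, by nondecreasing valuation *)
Definition nf_labels (s : seq nat) : seq nat :=
  nseq (count_mem 0%N s - count (ltn 1) s) 0%N ++
  nseq (count_mem 1%N s) 1%N ++ sort leq [seq i <- s | ltn 1 i].

Fact nf_size_labels n (l : nf_index n) : nf_size (nf_labels l) = n.
Proof.
have sz (s : seq nat) : nf_size s = (size s + count (ltn 1) s)%N.
  elim: s => //= i s; rewrite /nf_size /= => ->.
  by case: i => [|[|i]]; rewrite /= ?add0n ?add1n ?addSn ?addnS //.
have cnt (s : seq nat) :
    size s = (count_mem 0%N s + count_mem 1%N s + count (ltn 1) s)%N.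
  by elim: s => //= i s ->; case: i => [|[|i]] /=; lia.
have srt (s : seq nat) : count (ltn 1) (sort leq [seq i <- s | ltn 1 i])
    = count (ltn 1) s.
  have /permP -> := permEl (perm_sort leq [seq i <- s | ltn 1 i]).
  by rewrite count_filter; apply: eq_count => i /=; rewrite andbb.
have := cnt l; have := nf_zeros l; rewrite size_tuple sz /nf_labels.
rewrite !size_cat !count_cat !size_nseq !count_nseq srt size_sort size_filter.
by move: (count _ l) => m; rewrite /= !mul0n !add0n; lia.
Qed.

Fact nf_blockdiag_unit s : nf_blockdiag s \in unitmx.
Proof.
have z0 : z != 0.
  rewrite tofrac_eq0; apply/eqP => /(congr1 (fun a => pscoef a 1)) /= /eqP.
  by rewrite oner_eq0.
elim: s => [|i s IHs] /=; first by rewrite unitmxE det_mx00 unitr1.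
rewrite unitmxE (@det_ublock _ (nf_block_size i) (nf_size s)) unitrM.
rewrite -!unitmxE IHs andbT unitmxE.
case: i => [|[|i]] /=; first by rewrite det1 unitr1.
  by rewrite det_scalar unitfE expf_neq0.
rewrite (@det_ublock _ 1 1) det1 mul1r det_scalar unitfE.
by rewrite !expf_neq0.
Qed.

Fact nf_mx_unit n (l : nf_index n) :
  castmx (nf_size_labels l, nf_size_labels l) (nf_blockdiag (nf_labels l))
    \in unitmx.
Proof.
have castu m p (e : m = p) (A : 'M[laurent k]_m) :
  A \in unitmx -> castmx (e, e) A \in unitmx by case: _ / e; rewrite castmx_id.
exact: (castu _ _ (nf_size_labels l) _ (nf_blockdiag_unit _)).
Qed.

(** $\Pi^\lambda$ *)
Definition normal_form n (l : nf_index n) : GLn k n := MkGLn (nf_mx_unit l).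

(** $K \Pi^\lambda H$ *)
Definition nf_coset n (l : nf_index n) : set (GLn k n) :=
  [set x | exists a b, [/\ GLint a, GLsq b & x = (a * normal_form l * b)%g]].

End NormalForms.

Definition GLborel (k : fieldType) (n : nat) :=
  g_sigma_algebraType (@open (GLn k n)).

Section Haar.
Variables (k : fieldType) (n : nat) (R : realType).
Variable mu : {measure set (GLborel k n) -> \bar R}.
Local Notation G := (GLn k n).
Local Open Scope ereal_scope.

(** A nonzero left-invariant Radon measure *)
Definition is_haar : Prop :=
  [/\ mu setT != 0,
      (forall (g : G) (A : set (GLborel k n)), measurable A ->
         mu [set (g * x)%g | x in (A : set G)] = mu A),
      (forall C : set G, compact C -> mu C < +oo),
      (forall A : set (GLborel k n), measurable A ->
         mu A = ereal_inf [set mu U | U in [set U : set G | open U /\ A `<=` U]])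
    & (forall U : set G, open U ->
         mu U = ereal_sup [set mu C | C in [set C : set G | compact C /\ C `<=` U]])].

Local Close Scope ereal_scope.

Definition cintegrable (f : G -> R[i]) : Prop :=
  mu.-integrable setT (fun x => (complex.Re (f x))%:E) /\
  mu.-integrable setT (fun x => (complex.Im (f x))%:E).

Definition cintegral (f : G -> R[i]) : R[i] :=
  Complex (\int[mu]_x complex.Re (f x)) (\int[mu]_x complex.Im (f x)).

End Haar.

Section Hecke.
Variables (k : fieldType) (n : nat) (R : realType).
Local Notation G := (GLn k n).
(** [R[i]^o] is [R[i]] regarded as a vector space over itself, so that
    [G -> R[i]^o] is a vector space for the pointwise operations. *)
Local Notation C := (R[i]^o).

Definition hecke_algebra : set (G -> C) :=
  [set f | [/\ continuous f, compact (closure [set x | f x != 0])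
             & forall a x b, GLint a -> GLint b -> f (a * x * b)%g = f x]].

Definition hecke_one : G -> C := \1_(@GLint k n).

Definition hecke_basis (l : nf_index n) : G -> C := \1_(nf_coset l).

Definition hecke_module : set (G -> C) :=
  [set g | exists (s : seq (nf_index n)) (c : nf_index n -> R[i]),
     g = \sum_(l <- s) c l *: hecke_basis l].

Variable mu : {measure set (GLborel k n) -> \bar R}.

Definition hecke_mul (f1 f2 : G -> C) : G -> C :=
  fun x => cintegral mu (fun y => f1 (x * y)%g * f2 (y^-1)%g).

Definition hecke_act (f g : G -> C) : G -> C :=
  fun x => cintegral mu (fun y => g (y^-1 * x)%g * f y).

End Hecke.

(** Given a linear subspace [A] of [V] which is an algebra for the product [mul]
    and the identity [e], [act] makes the subset [M] of [W] a left [A]-module,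
    the vector space structure induced on [M] being the one of [W]. *)
Definition is_left_module (F : fieldType) (V W : lmodType F)
    (A : set V) (mul : V -> V -> V) (e : V)
    (M : set W) (act : V -> W -> W) : Prop :=
  (M 0 /\ (forall (c : F) (g h : W), M g -> M h -> M (c *: g + h))) /\
  [/\ (forall f g, A f -> M g -> M (act f g)),
      (forall f (c : F) g h, A f -> M g -> M h ->
         act f (c *: g + h) = c *: act f g + act f h),
      (forall (c : F) f1 f2 g, A f1 -> A f2 -> M g ->
         act (c *: f1 + f2) g = c *: act f1 g + act f2 g),
      (forall f1 f2 g, A f1 -> A f2 -> M g ->
         act (mul f1 f2) g = act f1 (act f2 g))
    & (forall g, M g -> act e g = g)].

(* Main.v *)
(** A function on [G] which is right [K]-invariant and supported on finitely
    many cosets [aK] is integrated by summing its values at representatives of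
    these cosets, each of which is open of measure [1].
    All the integrals at hand are of this kind, the Hecke algebra consisting
    of bi-invariant functions with compact support, so that the product of the
    algebra and the action are given by the same finite sums and the module
    axioms reduce to left invariance of these sums.

    The product of [f] and [d_lambda] is left [K]- and right [H]-invariant and
    is supported on finitely many double cosets [K b Pi^lambda H]. It is a
    combination of the basis because each of these contains a [Pi^mu]: let
    [sigma] be the involution [z |-> -z]. Then [s = sigma(x) x^-1] satisfies
    [sigma(s) s = 1], the double coset of [x] is determined by the class of [s]
    under [s |-> sigma(u) s u^-1] with [u] in [K], and [s] is the matrix of a
    semilinear involution of [k((z))^n] in a basis of the lattice [k[[z]]^n],
    which it need not preserve. If [s] has a pole of order [m > 0], its polar
    part has square [0] modulo [z], which gives a rank two block of label
    [m + 1]; if [s] is integral, it is an involution modulo [z], and lifting an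
    eigenvector gives a rank one block. In both cases the block has a stable
    complement. *)
From HB Require Import structures.
From mathcomp Require Import all_boot all_order all_algebra.
From mathcomp Require Import fraction zify.
From mathcomp Require Import complex.
From mathcomp Require Import all_classical all_reals all_analysis.
From mathcomp Require Import measurable_realfun.
Require Import Defs.

Set Implicit Arguments.
Unset Strict Implicit.
Unset Printing Implicit Defensive.

Import Order.TTheory GRing.Theory Num.Theory.

Local Open Scope classical_set_scope.
Local Open Scope ring_scope.

(** * Power series, Laurent series and the involution z |-> -z *)

Section PowerSeriesTheory.
Variable k : fieldType.
Implicit Types a b c : pseries k.

Definition psconst a : k := pscoef a 0.

Fact psconst_additive : zmod_morphism psconst.
Proof. by []. Qed.
HB.instance Definition _ :=
  GRing.isZmodMorphism.Build (pseries k) k psconst psconst_additive.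

Fact psconst_multiplicative : monoid_morphism psconst.
Proof. by split=> // a b; rewrite /psconst /= big_ord1. Qed.
HB.instance Definition _ :=
  GRing.isMonoidMorphism.Build (pseries k) k psconst psconst_multiplicative.

Definition psC (x : k) : pseries k := PSeries (fun i => if i == 0%N then x else 0).

Fact psC_additive : zmod_morphism psC.
Proof.
by move=> x y; apply: pseriesP => -[|i] //=; rewrite subrr.
Qed.
HB.instance Definition _ :=
  GRing.isZmodMorphism.Build k (pseries k) psC psC_additive.

Fact psC_multiplicative : monoid_morphism psC.
Proof.
split=> [|x y]; first by apply: pseriesP => -[|i].
apply: pseriesP => i /=; rewrite big_ord_recl /= subn0 big1 ?addr0 => [|j _].
  by case: i => //= i; rewrite mulr0.
by rewrite mul0r.
Qed.
HB.instance Definition _ :=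
  GRing.isMonoidMorphism.Build k (pseries k) psC psC_multiplicative.

Lemma psX_neq0 : psX k != 0.
Proof.
by apply/eqP => /(congr1 (fun a => pscoef a 1)) /= /eqP; rewrite oner_eq0.
Qed.

Lemma pscoef_psXM a i : pscoef (psX k * a) i = if i is j.+1 then pscoef a j else 0.
Proof.
case: i => [|i] /=; first by rewrite big_ord1 mul0r.
rewrite !big_ord_recl mul0r add0r /= mul1r subSS subn0 big1 ?addr0 // => j _.
by rewrite mul0r.
Qed.

Lemma pscoef_psXnM m a i : (i < m)%N -> pscoef (psX k ^+ m * a) i = 0.
Proof.
elim: m i => // m IHm [|i] im; rewrite exprS -mulrA pscoef_psXM //.
exact: IHm.
Qed.

Lemma psconst_eq0 a : psconst a = 0 -> exists b, a = psX k * b.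
Proof.
move=> a0; exists (PSeries (fun i => pscoef a i.+1)).
by apply: pseriesP => -[|i]; rewrite pscoef_psXM.
Qed.

(** Geometric series: $z$ divides $c$, so $c^j$ vanishes below degree $j$, and the coefficient of
    degree $i$ of the inverse is that of the sum of the $c^j$ with $j \le i$. *)
Lemma psunit_sub1 c : psconst c = 0 -> 1 - c \is a GRing.unit.
Proof.
move=> /psconst_eq0[d cE].
have geom m : (\sum_(j < m) c ^+ j) * (1 - c) = 1 - c ^+ m.
  by rewrite mulrC -opprB mulNr -subrX1 opprB.
have coef_sum m (F : 'I_m -> pseries k) i :
    pscoef (\sum_(j < m) F j) i = \sum_(j < m) pscoef (F j) i.
  by elim/big_rec2: _ => //= j x y _ <-.
have cX0 j i : (i < j)%N -> pscoef (c ^+ j) i = 0.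
  by move=> ij; rewrite cE exprMn pscoef_psXnM.
have [b bE] : exists b, forall m i, (i < m)%N ->
    pscoef b i = pscoef (\sum_(j < m) c ^+ j) i.
  exists (PSeries (fun i => pscoef (\sum_(j < i.+1) c ^+ j) i)) => m i im.
  rewrite -(subnKC im) /= !coef_sum big_split_ord /=.
  by rewrite [X in _ + X]big1 ?addr0 // => j _; rewrite cX0 // ltn_addr.
have b1 : b * (1 - c) = 1.
  apply: pseriesP => i; transitivity (pscoef (1 - c ^+ i.+1) i).
    rewrite -geom; apply: eq_bigr => j _; congr (_ * _).
    exact: bE.
  by rewrite [LHS]/= cX0 // oppr0 addr0.
by apply/unitrP; exists b; split=> //; rewrite mulrC.
Qed.

(** Dividing by the constant term leaves a series $1 - c$ with $c(0) = 0$. *)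
Lemma psunitE a : (a \is a GRing.unit) = (psconst a != 0).
Proof.
apply/idP/idP => [ua|a0].
  by move: (rmorph_unit psconst ua); rewrite unitfE.
have -> : a = psC (psconst a) * (1 - (1 - psC (psconst a)^-1 * a)).
  by rewrite subKr mulrA -rmorphM divff // rmorph1 mul1r.
rewrite unitrM rmorph_unit ?unitfE // psunit_sub1 //.
by rewrite rmorphB rmorph1 rmorphM /= mulVf // subrr.
Qed.

Lemma pseries_factor a : a != 0 ->
  exists m u, u \is a GRing.unit /\ a = psX k ^+ m * u.
Proof.
move=> a0; have : exists i, pscoef a i != 0.
  apply: contrapT => H; case/eqP: a0; apply: pseriesP => i /=.
  by apply: contrapT => /eqP ai; apply: H; exists i.
case=> i; elim: i a {a0} => [|i IHi] a ai.
  by exists 0%N, a; rewrite psunitE expr0 mul1r.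
have [a0|a0] := eqVneq (psconst a) 0; last first.
  by exists 0%N, a; rewrite psunitE expr0 mul1r.
have [b ab] := psconst_eq0 a0; have /IHi[m [u [uu bE]]] : pscoef b i != 0.
  by move: ai; rewrite ab pscoef_psXM.
by exists m.+1, u; split=> //; rewrite exprS -mulrA -bE.
Qed.

(** The automorphism $z \mapsto -z$; when 2 is invertible, its fixed ring is $k[[z^2]]$. *)
Definition pssig a : pseries k := PSeries (fun i => (-1) ^+ i * pscoef a i).

Fact pssig_additive : zmod_morphism pssig.
Proof. by move=> a b; apply: pseriesP => i /=; rewrite mulrBr. Qed.
HB.instance Definition _ :=
  GRing.isZmodMorphism.Build (pseries k) (pseries k) pssig pssig_additive.

Fact pssig_multiplicative : monoid_morphism pssig.
Proof.
split=> [|a b]; first by apply: pseriesP => -[|i] /=; rewrite ?mulr0 ?mulr1.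
apply: pseriesP => i /=; rewrite mulr_sumr; apply: eq_bigr => j _.
have ji : (j <= i)%N by rewrite -ltnS.
by rewrite mulrACA -exprD subnKC.
Qed.
HB.instance Definition _ :=
  GRing.isMonoidMorphism.Build (pseries k) (pseries k) pssig pssig_multiplicative.

Lemma pssigK : involutive pssig.
Proof.
move=> a; apply: pseriesP => i /=.
by rewrite mulrA -exprD -signr_odd oddD addbb mul1r.
Qed.

Lemma pssig_eq0 a : (pssig a == 0) = (a == 0).
Proof. by rewrite -(inj_eq (can_inj pssigK)) pssigK raddf0. Qed.

Lemma psconst_sig a : psconst (pssig a) = psconst a.
Proof. by rewrite /psconst /= mul1r. Qed.

Lemma pssig_psX : pssig (psX k) = - psX k.
Proof.
by apply: pseriesP => -[|[|i]] /=; rewrite ?mulr0 ?oppr0 ?mulr1.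
Qed.

Lemma pssigC x : pssig (psC x) = psC x.
Proof. by apply: pseriesP => -[|i] /=; rewrite ?mul1r ?mulr0. Qed.

Lemma even_pssig a : even_pseries a -> pssig a = a.
Proof.
move=> ea; apply: pseriesP => i /=; rewrite -signr_odd.
by case: (boolP (odd i)) => oi; rewrite ?mul1r // ea ?mulr0.
Qed.

Lemma pssig_even a : (2%:R : k) != 0 -> pssig a = a -> even_pseries a.
Proof.
move=> k2 sa i oi; have := congr1 (fun b => pscoef b i) sa.
rewrite /= -signr_odd oi expr1 mulN1r => /eqP.
rewrite eq_sym -addr_eq0 -mulr2n -mulr_natl mulf_eq0 (negPf k2) /=.
by move/eqP.
Qed.

End PowerSeriesTheory.

(** * Laurent series: the involution on fractions, denominators and poles *)

Section LaurentTheory.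
Variable k : fieldType.
Implicit Types (a b c d : pseries k) (x y : laurent k).

Definition psfrac : pseries k -> laurent k := @tofrac (pseries k).
HB.instance Definition _ := GRing.RMorphism.copy psfrac (@tofrac (pseries k)).

Lemma psfrac_eq0 a : (psfrac a == 0) = (a == 0).
Proof. exact: tofrac_eq0. Qed.

Lemma psfrac_inj : injective psfrac.
Proof. by move=> a b /eqP; rewrite -subr_eq0 -rmorphB psfrac_eq0 subr_eq0 => /eqP. Qed.

Lemma psfrac_psX : psfrac (psX k) = lz k.
Proof. by []. Qed.

Lemma lz_neq0 : lz k != 0.
Proof. by rewrite -psfrac_psX psfrac_eq0 psX_neq0. Qed.

Lemma laurent_frac x : exists a b, b != 0 /\ x = psfrac a / psfrac b.
Proof.
elim/quotW: x => r; exists (val r).1, (val r).2; split; first exact: denom_ratioP.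
apply/eqP; rewrite -[_ / _]/(FracField.mul _ (FracField.inv _)) !piE.
rewrite /FracField.mulf /FracField.invf !numden_Ratio ?denom_ratioP ?oner_eq0 //.
by rewrite mulr1 mul1r FracField.Ratio_numden.
Qed.


Lemma laurent_intP x : laurent_int x <-> exists a, x = psfrac a.
Proof. by split=> [[a _ <-]|[a ->]]; exists a. Qed.

(** The value is chosen among those given by the fractions representing [x]. There is one by
    [laurent_frac], and they all agree by [lsigE], so the default 0 is never met. *)
Definition lsig x : laurent k := xget 0 [set y | exists a b,
  [/\ b != 0, x = psfrac a / psfrac b & y = psfrac (pssig a) / psfrac (pssig b)]].

Lemma lsigE a b : b != 0 ->
  lsig (psfrac a / psfrac b) = psfrac (pssig a) / psfrac (pssig b).
Proof.
move=> b0; apply: xget_unique; first by exists a, b.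
move=> y [c [d [d0 /eqP ecd ->]]]; apply/eqP; move: ecd.
rewrite !eqr_div ?psfrac_eq0 ?pssig_eq0 // -!rmorphM /= => /eqP /psfrac_inj ->.
by rewrite mulrC.
Qed.

Fact lsig_additive : zmod_morphism lsig.
Proof.
move=> x y; have [a [b [b0 ->]]] := laurent_frac x.
have [c [d [d0 ->]]] := laurent_frac y.
rewrite -mulNr addf_div ?psfrac_eq0 // -rmorphN -!rmorphM -rmorphD /=.
rewrite !lsigE ?mulf_neq0 // -mulNr addf_div ?psfrac_eq0 ?pssig_eq0 //.
by rewrite -rmorphN -!rmorphM -rmorphD /= !(rmorphD, rmorphM, rmorphN).
Qed.
HB.instance Definition _ :=
  GRing.isZmodMorphism.Build (laurent k) (laurent k) lsig lsig_additive.

Fact lsig_multiplicative : monoid_morphism lsig.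
Proof.
split=> [|x y].
  have := @lsigE 1 1 (oner_neq0 _).
  by rewrite !rmorph1 divr1.
have [a [b [b0 ->]]] := laurent_frac x.
have [c [d [d0 ->]]] := laurent_frac y.
rewrite mulf_div -!rmorphM /= !lsigE ?mulf_neq0 // mulf_div.
by rewrite -!rmorphM /= !rmorphM.
Qed.
HB.instance Definition _ :=
  GRing.isMonoidMorphism.Build (laurent k) (laurent k) lsig lsig_multiplicative.

Lemma lsig_psfrac a : lsig (psfrac a) = psfrac (pssig a).
Proof.
by have := @lsigE a 1 (oner_neq0 _); rewrite !rmorph1 !divr1.
Qed.

Lemma lsig_lz : lsig (lz k) = - lz k.
Proof. by rewrite -psfrac_psX lsig_psfrac pssig_psX rmorphN. Qed.

Lemma lsigK : involutive lsig.
Proof.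
move=> x; have [a [b [b0 ->]]] := laurent_frac x.
by rewrite !lsigE ?pssig_eq0 // !pssigK.
Qed.

(** A fixed $a/b$ equals $a\sigma(b)/(b\sigma(b))$: the denominator is fixed by $\sigma$, hence so
    is the numerator, and fixed power series are even. *)
Lemma laurent_sqP x : (2%:R : k) != 0 -> laurent_sq x <-> lsig x = x.
Proof.
move=> k2; split=> [[a [b [ea eb b0 ->]]]|].
  by rewrite lsigE // !even_pssig.
move=> sx; have [a [b [b0 xE0]]] := laurent_frac x; move: sx; rewrite {}xE0 => sx.
pose c := b * pssig b; have c0 : c != 0 by rewrite mulf_neq0 ?pssig_eq0.
have xE : psfrac a / psfrac b = psfrac (a * pssig b) / psfrac c.
  by rewrite !rmorphM /= -mulf_div divff ?mulr1 // psfrac_eq0 pssig_eq0.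
have sc : pssig c = c by rewrite rmorphM /= pssigK mulrC.
exists (a * pssig b), c; split=> //; [|exact: pssig_even].
apply: pssig_even => //; move: sx; rewrite {1 2}xE lsigE // sc.
have c0' : psfrac c != 0 by rewrite psfrac_eq0.
by move/(divIf c0')/psfrac_inj.
Qed.

Lemma laurent_denom x : exists m a, lz k ^+ m * x = psfrac a.
Proof.
have [a [b [b0 ->]]] := laurent_frac x.
have [m [u [uu ->]]] := pseries_factor b0.
exists m, (a * u^-1); rewrite !rmorphM /= rmorphXn /= psfrac_psX rmorphV //=.
by rewrite invfM mulrCA [X in _ * X]mulrA divff ?mul1r // expf_neq0 ?lz_neq0.
Qed.

Lemma mx_denom m n (M : 'M[laurent k]_(m, n)) :
  exists N A, lz k ^+ N *: M = map_mx psfrac A.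
Proof.
pose N i j := projT1 (cid (laurent_denom (M i j))).
pose a i j := projT1 (cid (projT2 (cid (laurent_denom (M i j))))).
have aE i j : lz k ^+ N i j * M i j = psfrac (a i j).
  exact: projT2 (cid (projT2 (cid (laurent_denom (M i j))))).
(* The sum of the exponents bounds each of them, so it serves as a common exponent. *)
pose S := (\sum_i \sum_j N i j)%N.
have NS i j : (N i j <= S)%N.
  by rewrite /S (bigD1 i) //= (bigD1 j) //= -addnA leq_addr.
exists S, (\matrix_(i, j) (psX k ^+ (S - N i j) * a i j)).
apply/matrixP => i j; rewrite !mxE rmorphM /= -aE rmorphXn /= psfrac_psX.
by rewrite mulrA -exprD subnK.
Qed.

Lemma mx_const_eq0 m n (A : 'M[pseries k]_(m, n)) :
  map_mx (@psconst k) A = 0 -> exists B, A = psX k *: B.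
Proof.
move=> A0; have eB i j : exists b, A i j = psX k * b.
  by apply: psconst_eq0; move/matrixP/(_ i j): A0; rewrite !mxE.
exists (\matrix_(i, j) projT1 (cid (eB i j))); apply/matrixP => i j.
by rewrite !mxE; case: cid.
Qed.

(** A factor $z$ can be cancelled as long as the reduction modulo $z$ vanishes; so either no pole
    remains or [N.+1] is its exact order. *)
Lemma mx_pole m n (M : 'M[laurent k]_(m, n)) :
  (exists A, M = map_mx psfrac A) \/
  (exists N A, lz k ^+ N.+1 *: M = map_mx psfrac A /\ map_mx (@psconst k) A != 0).
Proof.
have [N] := mx_denom M; elim: N => [|N IHN] [A AE].
  by left; exists A; rewrite -AE scale1r.
have [A0|A0] := eqVneq (map_mx (@psconst k) A) 0; last by right; exists N, A.
have [B BE] := mx_const_eq0 A0; apply: IHN; exists B.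
apply: (can_inj (scalerK (lz_neq0 ))).
by rewrite scalerA -exprS AE BE map_mxZ.
Qed.

End LaurentTheory.

(** * Semilinear involutions of k((z))^n *)

Section TwistedEquivalence.
Variable k : fieldType.
Local Notation O := (pseries k).
Local Notation F := (laurent k).
Local Notation ps := (map_mx (@psfrac k)).
Local Notation sO := (map_mx (@pssig k)).
Local Notation sF := (map_mx (@lsig k)).
Local Notation cst := (map_mx (@psconst k)).

Lemma map_psfrac_inj m n :
  injective (map_mx (@psfrac k) : 'M[_]_(m, n) -> 'M[_]_(m, n)).
Proof.
move=> A B /matrixP AB; apply/matrixP => i j; apply: psfrac_inj.
by have := AB i j; rewrite !mxE.
Qed.

Lemma map_lsig_psfrac m n (A : 'M[O]_(m, n)) : sF (ps A) = ps (sO A).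
Proof. by apply/matrixP => i j; rewrite !mxE lsig_psfrac. Qed.

Lemma map_lsigK m n : involutive (map_mx (@lsig k) : 'M[_]_(m, n) -> 'M[_]_(m, n)).
Proof. by move=> A; apply/matrixP => i j; rewrite !mxE lsigK. Qed.

Lemma map_pssigK m n : involutive (map_mx (@pssig k) : 'M[_]_(m, n) -> 'M[_]_(m, n)).
Proof. by move=> A; apply/matrixP => i j; rewrite !mxE pssigK. Qed.

Lemma map_psconst_sig m n (A : 'M[O]_(m, n)) : cst (sO A) = cst A.
Proof. by apply/matrixP => i j; rewrite !mxE psconst_sig. Qed.

Lemma map_psCK m n (A : 'M[k]_(m, n)) : cst (map_mx (@psC k) A) = A.
Proof. by apply/matrixP => i j; rewrite !mxE. Qed.

(** [t = sF U *m s *m U^-1] with [U] invertible over [k[[z]]]. The sizes may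
    differ syntactically, so that block diagonal matrices can be reordered and
    reassociated without casts. *)
Definition twisted m p (s : 'M[F]_m) (t : 'M[F]_p) :=
  exists (U : 'M[O]_(p, m)) (V : 'M[O]_(m, p)),
    [/\ U *m V = 1%:M, V *m U = 1%:M & t *m ps U = ps (sO U) *m s].

Lemma twisted_refl m (s : 'M[F]_m) : twisted s s.
Proof. by exists 1%:M, 1%:M; rewrite !mulmx1 !map_mx1 mulmx1 mul1mx. Qed.

Lemma twisted_trans m p q (s : 'M[F]_m) (t : 'M[F]_p) (u : 'M[F]_q) :
  twisted s t -> twisted t u -> twisted s u.
Proof.
move=> [U [V [UV VU sU]]] [U' [V' [UV' VU' sU']]].
exists (U' *m U), (V *m V'); split.
- by rewrite mulmxA -(mulmxA U') UV mulmx1.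
- by rewrite mulmxA -(mulmxA V) VU' mulmx1.
- by rewrite !map_mxM /= mulmxA sU' -!mulmxA sU.
Qed.

Lemma twisted_sym m p (s : 'M[F]_m) (t : 'M[F]_p) : twisted s t -> twisted t s.
Proof.
move=> [U [V [UV VU sU]]]; exists V, U; split=> //.
have sVU : ps (sO V) *m ps (sO U) = 1%:M by rewrite -!map_mxM VU !map_mx1.
rewrite -[s]mul1mx -sVU -(mulmxA _ _ s) -sU -!mulmxA -map_mxM UV map_mx1.
by rewrite mulmx1.
Qed.

Lemma twisted_cast m p (e : m = p) (s : 'M[F]_m) : twisted s (castmx (e, e) s).
Proof. by case: p / e; rewrite castmx_id; exact: twisted_refl. Qed.

Lemma twisted_block m p m' p' (s : 'M[F]_m) (t : 'M[F]_p)
    (s' : 'M[F]_m') (t' : 'M[F]_p') :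
  twisted s t -> twisted s' t' ->
  twisted (block_mx s 0 0 s') (block_mx t 0 0 t').
Proof.
move=> [U [V [UV VU sU]]] [U' [V' [UV' VU' sU']]].
exists (block_mx U 0 0 U'), (block_mx V 0 0 V'); split.
- by rewrite mulmx_block !mulmx0 !mul0mx !addr0 !add0r UV UV' -scalar_mx_block.
- by rewrite mulmx_block !mulmx0 !mul0mx !addr0 !add0r VU VU' -scalar_mx_block.
- rewrite !map_block_mx !map_mx0 !mulmx_block !mulmx0 !mul0mx !addr0 !add0r.
  by rewrite sU sU'.
Qed.

Lemma twisted_swap m p (s : 'M[F]_m) (t : 'M[F]_p) :
  twisted (block_mx s 0 0 t) (block_mx t 0 0 s).
Proof.
exists (block_mx 0 1%:M 1%:M 0), (block_mx 0 1%:M 1%:M 0); split.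
- rewrite mulmx_block !mulmx0 !mul0mx !addr0 !add0r !mulmx1.
  by rewrite -scalar_mx_block.
- rewrite mulmx_block !mulmx0 !mul0mx !addr0 !add0r !mulmx1.
  by rewrite -scalar_mx_block.
- rewrite !map_block_mx !map_mx0 !map_mx1 !mulmx_block.
  by rewrite !mulmx0 !mul0mx !addr0 !add0r !mul1mx !mulmx1.
Qed.

Lemma twisted_assoc m p q (s : 'M[F]_m) (t : 'M[F]_p) (u : 'M[F]_q) :
  twisted (block_mx s 0 0 (block_mx t 0 0 u)) (block_mx (block_mx s 0 0 t) 0 0 u).
Proof.
have := @block_mxA _ m p q m p q s 0 0 0 t 0 0 0 u.
rewrite /= !row_mx0 !col_mx0 => ->; apply: twisted_sym; exact: twisted_cast.
Qed.

(** The pseudo-inverse of the reduction, lifted to constant series, inverts [U] modulo $z$ on both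
    sides; the two products have determinants with constant term 1, hence are invertible. *)
Lemma psmx_inv m p (U : 'M[O]_(p, m)) : row_free (cst U) -> row_full (cst U) ->
  exists V, U *m V = 1%:M /\ V *m U = 1%:M.
Proof.
move=> fU gU; pose V0 := map_mx (@psC k) (pinvmx (cst U)).
have unit1 q (A : 'M[O]_q) : cst A = 1%:M -> A \in unitmx.
  move=> A1; rewrite unitmxE psunitE -[psconst _](det_map_mx (@psconst k)) A1.
  by rewrite det1 oner_neq0.
have u1 : U *m V0 \in unitmx by apply: unit1; rewrite map_mxM map_psCK mulmxVp.
have u2 : V0 *m U \in unitmx by apply: unit1; rewrite map_mxM map_psCK mulVpmx.
pose V := V0 *m invmx (U *m V0); exists V.
have UV : U *m V = 1%:M by rewrite mulmxA mulmxV.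
split=> //; pose V' := invmx (V0 *m U) *m V0.
have VU' : V' *m U = 1%:M by rewrite -mulmxA mulVmx.
by rewrite -[V]mul1mx -VU' -(mulmxA V') UV mulmx1.
Qed.

(** Given a family [E] of [r] vectors, part of a basis of the lattice, on which
    the semilinear involution [v |-> sF v *m s] acts by the matrix [T], a
    solution [X] of a linear equation yields a stable complement. *)
Lemma twisted_split r n (T : 'M[F]_r) (s : 'M[F]_n) (E : 'M[O]_(r, n)) :
    sF s *m s = 1%:M -> T *m ps E = ps (sO E) *m s -> row_free (cst E) ->
    (forall q (C : 'M[F]_(q, r)) (D : 'M[F]_q),
       (forall N A, lz k ^+ N *: s = ps A ->
          exists C' D', lz k ^+ N *: C = ps C' /\ lz k ^+ N *: D = ps D') ->
       sF C *m T + sF D *m C = 0 ->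
       exists X : 'M[O]_(q, r), ps (sO X) *m T + C = D *m ps X) ->
  exists q (D : 'M[F]_q),
    [/\ (r + q)%N = n, sF D *m D = 1%:M & twisted s (block_mx T 0 0 D)].
Proof.
move=> ss TE fE solve; set Ec := cst E; pose q := \rank (Ec^C)%MS.
have rqn : (r + q)%N = n.
  by rewrite /q mxrank_compl (eqP fE) subnKC // -(eqP fE) rank_leq_col.
(* [E] is completed to a basis of the lattice by constant vectors whose reductions span a complement
   of those of [E]. *)
pose W := map_mx (@psC k) (row_base (Ec^C)%MS).
pose U : 'M[O]_(r + q, n) := col_mx E W.
have rkU : \rank (cst U) = n.
  rewrite map_col_mx map_psCK -addsmxE (adds_eqmx (eqmx_refl _) (eq_row_base _)).
  by apply/eqP; exact: (addsmx_compl_full Ec).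
have fU : row_free (cst U) by rewrite /row_free rkU rqn.
have [|V [UV VU]] := psmx_inv fU; first by rewrite /row_full rkU.
pose s1 := ps (sO U) *m s *m ps V.
have VU1 : ps V *m ps U = 1%:M by rewrite -map_mxM VU map_mx1.
have s1U : s1 *m ps U = ps (sO U) *m s by rewrite -mulmxA VU1 mulmx1.
have s1s1 : sF s1 *m s1 = 1%:M.
  rewrite !map_mxM !map_lsig_psfrac map_pssigK /= -!mulmxA.
  have sVU : ps (sO V) *m ps (sO U) = 1%:M by rewrite -!map_mxM VU !map_mx1.
  rewrite /s1 -(mulmxA _ s) (mulmxA (ps (sO V))) sVU mul1mx.
  by rewrite (mulmxA (sF s)) ss mul1mx -map_mxM UV map_mx1.
(* [s1] is the matrix of the involution in the basis [U]; since the span of [E] is stable, its first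
   rows are [T] and 0. *)
have s1T : usubmx s1 = row_mx T 0.
  have EV : E *m V = row_mx 1%:M 0.
    have := congr1 usubmx UV; rewrite mul_col_mx col_mxKu => ->.
    by rewrite scalar_mx_block /block_mx col_mxKu.
  rewrite /s1 /U !map_col_mx !mul_col_mx col_mxKu -TE -mulmxA -map_mxM EV.
  by rewrite map_row_mx map_mx1 map_mx0 mul_mx_row mulmx1 mulmx0.
pose C := dlsubmx s1; pose D := drsubmx s1.
have s1E : s1 = block_mx T 0 C D.
  rewrite -[s1]submxK /C /D; congr block_mx.
    by rewrite /ulsubmx s1T row_mxKl.
  by rewrite /ursubmx s1T row_mxKr.
(* The lower blocks of $\sigma(s_1)s_1 = 1$ are the condition on [C] under which [solve] applies,
   and the involutivity of [D]. *)
move: s1s1; rewrite {1 2}s1E map_block_mx mulmx_block scalar_mx_block.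
move=> /eq_block_mx[_ _ CD DD].
have [|X XE] := solve q C D _ CD.
  move=> N A sA; have s1A : lz k ^+ N *: s1 = ps (sO U *m A *m V).
    by rewrite !map_mxM /= -sA -scalemxAr -scalemxAl.
  exists (dlsubmx (sO U *m A *m V)), (drsubmx (sO U *m A *m V)).
  by rewrite map_dlsubmx map_drsubmx -s1A; split; apply/matrixP => i j; rewrite !mxE.
exists q, D; split=> //.
  by move: DD; rewrite mulmx0 add0r.
apply: (@twisted_trans _ (r + q) _ _ s1); first by exists U, V.
(* Adding [X] times the first vectors to the others clears the lower left block. *)
exists (block_mx 1%:M 0 X 1%:M), (block_mx 1%:M 0 (- X) 1%:M); split.
- rewrite mulmx_block !mulmx0 !mul0mx !mulmx1 !mul1mx !addr0 !add0r subrr.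
  by rewrite -scalar_mx_block.
- rewrite mulmx_block !mulmx0 !mul0mx !mulmx1 !mul1mx !addr0 !add0r addNr.
  by rewrite -scalar_mx_block.
rewrite s1E !map_block_mx !map_mx1 !map_mx0 !mulmx_block.
by rewrite !mulmx0 !mul0mx !mulmx1 !mul1mx !addr0 !add0r XE.
Qed.

End TwistedEquivalence.

(** * Reduction of a semilinear involution to block diagonal form *)

Section TwistedNormalForm.
Variable k : fieldType.
Hypothesis k2 : (2%:R : k) != 0.
Local Notation O := (pseries k).
Local Notation F := (laurent k).
Local Notation ps := (map_mx (@psfrac k)).
Local Notation sO := (map_mx (@pssig k)).
Local Notation sF := (map_mx (@lsig k)).
Local Notation cst := (map_mx (@psconst k)).
Local Notation z := (lz k).
Local Notation half := (@psC k 2%:R^-1).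

(** This is $\sigma(B)B^{-1}$ for the block $B$ of label $i$; for $i > 1$ its upper right entry has
    a pole of order $i - 1$. *)
Definition nf_twist (i : nat) : 'M[F]_(nf_block_size i) :=
  match i return 'M[F]_(nf_block_size i) with
  | 0%N => 1%:M
  | 1%N => (-1)%:M
  | j.+2 => block_mx (1%:M : 'M[F]_1) (- (2%:R * z ^- j.+1))%:M
                     0 (((-1) ^+ j)%:M : 'M[F]_1)
  end.

Lemma nf_twistE i : nf_twist i *m nf_block k i = sF (nf_block k i).
Proof.
have z0 := lz_neq0 k.
case: i => [|[|j]] /=; first by rewrite map_mx1 mul1mx.
  by rewrite map_scalar_mx /= lsig_lz -scalar_mxM mulN1r.
rewrite [LHS](@mulmx_block _ 1 1 1 1 1 1) [RHS](@map_block_mx _ _ _ 1 1 1 1).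
rewrite map_mx1 !map_scalar_mx map_mx0.
rewrite !mul1mx !mulmx0 !mul0mx !add0r !addr0 -!scalar_mxM -raddfD /=.
rewrite rmorphXn /= !lsig_lz [(- z) ^+ _]exprNn.
rewrite [(-1) ^+ j.+2]exprS [(-1) ^+ j.+1]exprS !mulN1r opprK.
suff -> : z + - (2%:R / z ^+ j.+1) * z ^+ j.+2 = - z by [].
rewrite [z ^+ j.+2]exprS mulNr -mulrA [_ * (z * _)]mulrCA mulVf ?mulr1 ?expf_neq0 //.
by rewrite mulr_natl mulr2n opprD addrA subrr add0r.
Qed.

Fixpoint nf_twistdiag (s : seq nat) : 'M[F]_(nf_size s) :=
  match s return 'M[F]_(nf_size s) with
  | [::] => 0
  | i :: s' => block_mx (nf_twist i) 0 0 (nf_twistdiag s')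
  end.

Lemma nf_twistdiagE s : nf_twistdiag s *m nf_blockdiag k s = sF (nf_blockdiag k s).
Proof.
elim: s => [|i s IHs] /=; first by apply/matrixP => -[].
rewrite [LHS](@mulmx_block _ (nf_block_size i) (nf_size s)).
rewrite [RHS](@map_block_mx _ _ _ (nf_block_size i) (nf_size s)).
by rewrite !map_mx0 !mulmx0 !mul0mx !add0r !addr0 nf_twistE IHs.
Qed.

Lemma nf_twistdiag_cat s1 s2 : twisted (nf_twistdiag (s1 ++ s2))
  (block_mx (nf_twistdiag s1) 0 0 (nf_twistdiag s2)).
Proof.
elim: s1 => [|i s1 IHs] /=.
  have -> : block_mx 0 0 0 (nf_twistdiag s2) = nf_twistdiag s2
      :> 'M[F]_(0 + nf_size s2).
    apply/matrixP => i j; case: (split_ordP i) => [[]//|i' ->].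
    case: (split_ordP j) => [[]//|j' ->]; rewrite block_mxEdr.
    by congr (nf_twistdiag s2 _ _); apply: val_inj.
  exact: twisted_refl.
apply: twisted_trans (twisted_assoc _ _ _).
exact: twisted_block (twisted_refl _) IHs.
Qed.

(** Exchanging adjacent segments of the list generates all permutations, and each exchange is a swap
    of diagonal blocks. *)
Lemma nf_twistdiag_perm s1 s2 : perm_eq s1 s2 ->
  twisted (nf_twistdiag s1) (nf_twistdiag s2).
Proof.
move=> s12; pose P s := twisted (nf_twistdiag s1) (nf_twistdiag s).
apply: (@catCA_perm_ind _ P _ _ _ s12 (twisted_refl _)); rewrite /P.
move=> a b c /twisted_trans; apply; rewrite !catA.
apply: twisted_trans (nf_twistdiag_cat _ _) _.
apply: twisted_trans (twisted_sym (nf_twistdiag_cat _ _)).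
apply: twisted_block (twisted_refl _).
apply: twisted_trans (nf_twistdiag_cat _ _) _.
apply: twisted_trans (twisted_sym (nf_twistdiag_cat _ _)).
exact: twisted_swap.
Qed.

(** For a constant vector $e_0 \neq 0$, one of $e_0 \pm e_0t$ is nonzero modulo $z$. With
    $\varepsilon = \pm 1$, the vector $e_0 + \varepsilon e_0t$ is an exact eigenvector of the
    semilinear involution, because $\sigma(t)t = 1$. *)
Lemma twisted_split_int n (t : 'M[O]_n) : (0 < n)%N ->
  sF (ps t) *m ps t = 1%:M ->
  exists i q (D : 'M[F]_q), [/\ (nf_block_size i + q)%N = n, sF D *m D = 1%:M &
    twisted (ps t) (block_mx (nf_twist i) 0 0 D)].
Proof.
case: n t => // n t _ st1.
have tt : sO t *m t = 1%:M.
  by apply: map_psfrac_inj; rewrite map_mxM -map_lsig_psfrac st1 map_mx1.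
have tt1 : cst t *m cst t = 1%:M.
  by rewrite -[X in X *m _]map_psconst_sig -map_mxM tt map_mx1.
have half2 : half * 2%:R = 1.
  by rewrite -(rmorph_nat (@psC k) 2) -rmorphM mulVf // rmorph1.
pose e0 : 'rV[k]_n.+1 := delta_mx 0 0.
have e0_neq0 : e0 != 0.
  by apply/eqP => /matrixP/(_ 0 0)/eqP; rewrite !mxE !eqxx oner_eq0.
have split_sign (e : O) : pssig e = e -> e * e = 1 ->
    (e0 + psconst e *: (e0 *m cst t) != 0) ->
  exists q (D : 'M[F]_q), [/\ (1 + q)%N = n.+1, sF D *m D = 1%:M &
    twisted (ps t) (block_mx ((psfrac e)%:M : 'M[F]_1) 0 0 D)].
  move=> se ee e0t; pose E0 := map_mx (@psC k) e0.
  have sE0 : sO E0 = E0 by apply/matrixP => a b; rewrite !mxE pssigC.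
  apply: (@twisted_split k 1 n.+1 (psfrac e)%:M (ps t) (E0 + e *: (E0 *m t)) st1).
  - rewrite -map_mxM -map_scalar_mx -map_mxM; congr map_mx.
    rewrite mul_scalar_mx scalerDr scalerA ee scale1r map_mxD map_mxZ map_mxM.
    by rewrite sE0 /= se mulmxDl -scalemxAl -mulmxA tt mulmx1 addrC.
  - rewrite map_mxD map_mxZ map_mxM map_psCK /row_free.
    by rewrite rank_rV e0t.
  (* With exponent 0, the bound on poles says that [C] and [D] are integral. *)
  move=> q C D int CD; have [|C' [D' [CE DE]]] := int 0%N t; first by rewrite scale1r.
  move: CE DE; rewrite expr0 !scale1r => CE DE; subst C D.
  move: CD; rewrite !map_lsig_psfrac => CD.
  have {}CD : D' *m sO C' = - (e *: C').
    apply: (can_inj (@map_pssigK _ _ _)); apply: map_psfrac_inj.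
    rewrite map_mxM map_pssigK map_mxN /= map_mxZ /= se map_mxM /=.
    apply/eqP; rewrite map_mxN -addr_eq0 -CD addrC -map_scalar_mx -map_mxM.
    by rewrite -map_mxM mul_mx_scalar.
  (* [X = - (e / 2) sigma(C)] averages the splitting over [sigma]. *)
  exists (- (half * e) *: sO C').
  rewrite -map_scalar_mx -!map_mxM -map_mxD; congr map_mx.
  rewrite map_mxZ map_pssigK -scalemxAr CD rmorphN rmorphM /= se pssigC.
  rewrite mul_mx_scalar scalerA scalerN scaleNr opprK scalerA mulrN.
  rewrite mulrCA ee mulr1 -mulrA ee mulr1 scaleNr.
  have {2}-> : C' = (half * 2%:R) *: C' by rewrite half2 scale1r.
  by rewrite mulr_natr mulr2n scalerDl addKr.
(* If the vector for the sign $+1$ vanishes then $e_0t = -e_0$ modulo $z$, and the one for $-1$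
   reduces to $2e_0 \neq 0$. *)
have [e0N|e0P] := eqVneq (e0 + e0 *m cst t) 0.
  exists 1%N; have [|||q [D [qn DD tD]]] := split_sign (-1).
  - by rewrite rmorphN1.
  - by rewrite mulrNN mulr1.
  - rewrite rmorphN1 scaleN1r.
    have -> : e0 *m cst t = - e0 by apply/eqP; rewrite -addr_eq0 addrC e0N.
    by rewrite opprK -mulr2n -scaler_nat scaler_eq0 negb_or k2.
  by exists q, D; rewrite rmorphN1 in tD.
exists 0%N; have [|||q [D [qn DD tD]]] := split_sign 1.
- exact: rmorph1.
- exact: mulr1.
- by rewrite rmorph1 scale1r.
by exists q, D; rewrite rmorph1 in tD.
Qed.

(** Here $\sigma(t)t = \pm z^{2m}$ with $m = N + 1$, so the reduction of [t] has square zero. A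
    constant vector $e$ with $et \neq 0$ modulo $z$, together with a multiple $e'$ of $z^me - et$,
    spans a stable plane on which the matrix is [nf_twist m.+1]. *)
Lemma twisted_split_pole n (s : 'M[F]_n) N (t : 'M[O]_n) :
  sF s *m s = 1%:M -> z ^+ N.+1 *: s = ps t -> cst t != 0 ->
  exists i q (D : 'M[F]_q), [/\ (nf_block_size i + q)%N = n, sF D *m D = 1%:M &
    twisted s (block_mx (nf_twist i) 0 0 D)].
Proof.
move=> ss st t0; set m := N.+1 in st; set Z := psX k ^+ m.
have z0 : z ^+ m != 0 by rewrite expf_neq0 ?lz_neq0.
have ZE : psfrac Z = z ^+ m by rewrite rmorphXn.
have sZ : pssig Z = (-1) ^+ m * Z.
  by rewrite rmorphXn /= pssig_psX [LHS]exprNn.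
have sz : lsig (z ^+ m) = (-1) ^+ m * z ^+ m by rewrite rmorphXn /= lsig_lz [LHS]exprNn.
have sE : s = z ^- m *: ps t by rewrite -st scalerA mulVf ?scale1r.
have half2 : half * 2%:R = 1.
  by rewrite -(rmorph_nat (@psC k) 2) -rmorphM mulVf // rmorph1.
have tt : sO t *m t = ((-1) ^+ m * (Z * Z))%:M.
  apply: map_psfrac_inj; rewrite map_mxM -map_lsig_psfrac -st map_mxZ /= sz.
  rewrite -scalemxAl -scalemxAr ss scalerA map_scalar_mx /= -mulrA.
  rewrite scale_scalar_mx mulr1; congr _%:M.
  by rewrite !rmorphM /= ZE rmorphXn rmorphN1.
have tt0 : cst t *m cst t = 0.
  rewrite -[X in X *m _]map_psconst_sig -map_mxM tt map_scalar_mx.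
  have Z0 : psconst Z = 0 by rewrite /Z exprS; exact: (pscoef_psXM _ 0).
   have c0 : psconst ((-1) ^+ m * (Z * Z)) = 0 by rewrite !rmorphM /= Z0 mul0r mulr0.
  by transitivity ((0 : k)%:M : 'M[k]_n); [rewrite -c0 | rewrite raddf0].
have [i ti] : exists i, row i (cst t) != 0.
  apply: contrapT => H; case/eqP: t0; apply/row_matrixP => i; rewrite row0.
  by apply: contrapT => /eqP ti; apply: H; exists i.
pose e0 : 'rV[k]_n := delta_mx 0 i; pose e := map_mx (@psC k) e0.
have e0t : e0 *m cst t != 0 by rewrite -rowE.
have se : sO e = e by apply/matrixP => a b; rewrite !mxE pssigC.
have twoF : (2%:R : F) != 0.
  by rewrite -(rmorph_nat (@psfrac k) 2) psfrac_eq0 -(rmorph_nat (@psC k) 2) fmorph_eq0.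
(* Solves $es = e - 2z^{-m}e'$, the first row of the block of label $m + 1$; it is integral because
   $t = z^ms$ is. *)
pose e' := half *: (Z *: e - e *m t).
have etO : e *m t = Z *: e - 2%:R *: e'.
  by rewrite scalerA [2%:R * _]mulrC half2 scale1r opprB addrC subrK.
have etE : ps e *m ps t = z ^+ m *: ps e - 2%:R *: ps e'.
  by rewrite -map_mxM etO map_mxB !map_mxZ /= -(rmorph_nat (@psfrac k) 2) -ZE.
have sts : ps (sO t) *m s = ((-1) ^+ m * z ^+ m)%:M.
  by rewrite -map_lsig_psfrac -st map_mxZ /= sz -scalemxAl ss scale_scalar_mx mulr1.
have es : ps e *m s = ps e - (2%:R * z ^- m) *: ps e'.
  rewrite sE -scalemxAr etE scalerBr !scalerA mulVf // scale1r.
  by rewrite [_^-1 * _]mulrC.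
have e's : ps (sO e') *m s = (-1) ^+ N *: ps e'.
  apply: (can_inj (scalerK twoF)); rewrite scalemxAl.
  have -> : 2%:R *: ps (sO e') = ((-1) ^+ m * z ^+ m) *: ps e - ps e *m ps (sO t).
    have -> : 2%:R *: ps (sO e') = ps (sO (2%:R *: e')).
      by rewrite !map_mxZ /= (rmorph_nat (@pssig k)) (rmorph_nat (@psfrac k)).
    have -> : 2%:R *: e' = Z *: e - e *m t by rewrite etO subKr.
    rewrite map_mxB map_mxB !map_mxZ map_mxM map_mxM se /= sZ.
    by rewrite rmorphM /= ZE rmorphXn rmorphN1.
  rewrite mulmxBl -scalemxAl -mulmxA sts mul_mx_scalar es.
  rewrite -scalerBr addrAC subrr add0r scalerN !scalerA.
  rewrite -scaleNr; congr (_ *: _).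
  by rewrite /m exprS mulN1r !mulNr opprK mulrCA -!mulrA mulfV // mulr1 mulrC.
have Tr : nf_twist m.+1 *m ps (col_mx e e') = ps (sO (col_mx e e')) *m s.
  rewrite !map_col_mx /= se mul_col_mx es e's.
  rewrite [LHS](@mul_block_col _ 1 1 1 1) mul0mx add0r !mul_scalar_mx scale1r.
  by rewrite scaleNr.
have fE : row_free (cst (col_mx e e')).
  have e'0 : cst e' = - (2%:R^-1 *: (e0 *m cst t)).
    have Z0 : psconst Z = 0 by rewrite /Z exprS; exact: (pscoef_psXM _ 0).
    by rewrite map_mxZ map_mxB map_mxZ map_mxM map_psCK /= Z0 scale0r sub0r scalerN.
  apply: inj_row_free => v; rewrite map_col_mx map_psCK e'0 -[v]hsubmxK mul_row_col.
  rewrite [lsubmx v]mx11_scalar [rsubmx v]mx11_scalar !mul_scalar_mx.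
  set a := lsubmx v 0 0; set b := rsubmx v 0 0 => vE.
  have a0 : a = 0.
    (* Multiplying the relation by the reduction of [t], whose square is 0, isolates the coefficient
       of $e_0$. *)
    have := congr1 (mulmx^~ (cst t)) vE.
    rewrite mul0mx mulmxDl scalerN mulNmx -!scalemxAl -(mulmxA _ (cst t)) tt0.
    rewrite mulmx0 !scaler0 oppr0 addr0 => /eqP.
    by rewrite scaler_eq0 (negPf e0t) orbF => /eqP.
  move: vE; rewrite a0 scale0r add0r scalerN scalerA => /eqP.
  rewrite oppr_eq0 scaler_eq0 (negPf e0t) orbF mulf_eq0 invr_eq0 (negPf k2) orbF.
  by move=> /eqP ->; rewrite !raddf0 row_mx0.
exists m.+1.
apply: (@twisted_split k 2 n (nf_twist m.+1) s (col_mx e e') ss Tr fE).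
(* The block size 2 is displayed as [1 + 1], so that [C] splits into two columns. *)
move=> q; change (forall (C : 'M[F]_(q, 1 + 1)) (D : 'M[F]_q),
  (forall N A, z ^+ N *: s = ps A -> exists (C' : 'M[O]_(q, 1 + 1)) D',
     z ^+ N *: C = ps C' /\ z ^+ N *: D = ps D') ->
  sF C *m nf_twist m.+1 + sF D *m C = 0 ->
  exists X : 'M[O]_(q, 1 + 1), ps (sO X) *m nf_twist m.+1 + C = D *m ps X).
move=> C D int CD; have [C' [D' [CE _]]] := int m t st.
move: CE CD; rewrite -[C]hsubmxK -[C']hsubmxK.
move: (lsubmx C) (rsubmx C) (lsubmx C') (rsubmx C') => C0 C1 C0' C1'.
rewrite scale_row_mx map_row_mx => /eq_row_mx[_ C1E].
(* The pole of [C1] has order at most $m$, like that of [s], so $C_1 = 2z^{-m}Y$ with [Y]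
   integral. *)
pose Y := ps (half *: C1').
have C1Y : C1 = (2%:R * z ^- m) *: Y.
  apply: (can_inj (scalerK z0)); rewrite C1E scalerA mulrCA mulfV // mulr1.
  rewrite /Y map_mxZ scalerA /= -(rmorph_nat (@psfrac k) 2).
  by rewrite -rmorphM mulrC half2 rmorph1 scale1r.
have c0 : 2%:R * z ^- m != 0 by rewrite mulf_neq0 // invr_eq0.
rewrite map_row_mx [X in X + _](@mul_row_block _ q 1 1 1 1).
rewrite mul_mx_row (@add_row_mx _ q 1 1).
rewrite -[X in _ = X](@row_mx0 _ q 1 1) => /(@eq_row_mx _ q 1 1)[_].
rewrite !mul_mx_scalar => CD.
(* With $X = (\sigma(Y), 0)$ the second column of $\sigma(X)T$ cancels that of [C]. The first column
   requires $Y + C_0 = D\sigma(Y)$, which is the condition [CD] transformed by $\sigma$. *)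
exists (row_mx (sO (half *: C1')) 0).
rewrite !map_row_mx map_pssigK !map_mx0.
rewrite [X in X + _](@mul_row_block _ q 1 1 1 1) mul_mx_row (@add_row_mx _ q 1 1).
rewrite !mul_mx_scalar ?mulmx0 ?mul0mx ?addr0 ?scaler0 ?addr0 scale1r -/Y -/m.
suff -> : Y + C0 = D *m ps (sO (half *: C1')) by rewrite scaleNr -C1Y addNr.
rewrite -map_lsig_psfrac -/Y; apply: (can_inj (@map_lsigK k _ _)).
rewrite map_mxD map_mxM map_lsigK; apply: (can_inj (scalerK c0)).
have sc : lsig (2%:R * z ^- m) = (-1) ^+ m * (2%:R * z ^- m).
  rewrite rmorphM (rmorph_nat (@lsig k)) fmorphV /= sz invfM -exprVn invrN1.
  by rewrite mulrCA.
(* The sign $(-1)^N$ of the block and the sign $(-1)^m$ of $\sigma(z^{-m})$ multiply to $-1$, as $m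
   = N + 1$. *)
have N2 : (-1) ^+ (N + m) = -1 :> F.
  by rewrite -signr_odd addnS /= addnn odd_double.
move/eqP: CD; rewrite -/m C1Y map_mxZ /= sc scalerA mulrA -exprD N2 mulN1r.
rewrite -scalemxAr !scaleNr -opprD -scalerDr addrC subr_eq0 => /eqP.
by rewrite [sF Y + _]addrC => <-.
Qed.

Lemma twisted_nf n (s : 'M[F]_n) : sF s *m s = 1%:M ->
  exists l, twisted s (nf_twistdiag l).
Proof.
elim/ltn_ind: n s => -[|n] IHn s ss.
  by exists [::]; rewrite (flatmx0 s) /=; exact: twisted_refl.
have [i [q [D [iq DD sD]]]] : exists i q (D : 'M[F]_q),
    [/\ (nf_block_size i + q)%N = n.+1, sF D *m D = 1%:M &
    twisted s (block_mx (nf_twist i) 0 0 D)].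
  case: (mx_pole s) => [[t st]|[N [t [st t0]]]].
    by subst s; exact: twisted_split_int.
  exact: twisted_split_pole st t0.
(* Blocks have positive size, so the dimension drops. *)
have [|l Dl] := IHn q _ D DD; first by rewrite -iq; case: i {sD iq} => [|[]].
exists (i :: l); apply: twisted_trans sD _.
exact: twisted_block (twisted_refl _) Dl.
Qed.

End TwistedNormalForm.

(** * Normal forms of double cosets *)

Lemma perm_nf_labels (t : seq nat) :
  perm_eq (nseq (count_mem 0%N t) 0%N ++ nseq (count_mem 1%N t) 1%N ++
           [seq i <- t | ltn 1 i]) t.
Proof.
apply/permP => a; rewrite !count_cat !count_nseq count_filter.
elim: t => [|i t IHt]; first by rewrite !muln0.
rewrite [RHS]/= -{}IHt; case: i => [|[|i]] /=.
all: rewrite ?andbF ?andbT /= !mulnDr ?muln1 ?muln0.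
all: by move: (count (predI _ _) t) (a 0 * _)%N (a 1 * _)%N => x y w; lia.
Qed.

Lemma nf_index_of_labels (t : seq nat) :
  exists l : nf_index (nf_size t), perm_eq t (nf_labels l).
Proof.
(* Each label greater than 1 belongs to a block of size 2, which brings an additional part 0. *)
pose parts := [seq i <- t | ltn 1 i] ++ nseq (count_mem 1%N t) 1%N ++
  nseq (count_mem 0%N t + count (ltn 1) t) 0%N.
pose s := sort geq parts; have sE := permEl (perm_sort geq parts).
have cnt a : count a s = (count (predI a (ltn 1)) t + a 1%N * count_mem 1%N t +
    a 0%N * (count_mem 0%N t + count (ltn 1) t))%N.
  by move/permP: sE => ->; rewrite !count_cat !count_nseq count_filter addnA.
have c0 : count (predI (pred1 0%N) (ltn 1)) t = 0%N.
  by apply/eqP; rewrite -leqn0 leqNgt -has_count; apply/hasPn => -[].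
have c1 : count (predI (pred1 1%N) (ltn 1)) t = 0%N.
  by apply/eqP; rewrite -leqn0 leqNgt -has_count; apply/hasPn => -[|[]].
have cc : count (predI (ltn 1) (ltn 1)) t = count (ltn 1) t.
  by apply: eq_count => i /=; rewrite andbb.
have s0 := cnt (pred1 0%N); have s1 := cnt (pred1 1%N); have s2 := cnt (ltn 1).
rewrite ?c0 ?c1 ?cc /= ?mul0n ?mul1n ?addn0 ?add0n in s0 s1 s2.
have size_s : size s == nf_size t.
  rewrite -[size s]count_predT cnt !mul1n -size_filter.
  have := perm_nf_labels t; move/perm_map => /(_ _ nf_block_size)/perm_sumn.
  rewrite /nf_size => <-; rewrite !map_cat !sumn_cat !map_nseq !sumn_nseq !mul1n.
  have -> : [seq i <- t | predI predT (ltn 1) i] = [seq i <- t | ltn 1 i] by [].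
  have <- : (2 * size [seq i <- t | ltn 1 i])%N =
      sumn [seq nf_block_size i | i <- [seq i <- t | ltn 1 i]].
    elim: t {parts s sE cnt c0 c1 cc s0 s1 s2} => //= i t IHt.
    by case: i => [|[|i]] //=; rewrite -IHt mulnS.
  by rewrite !size_filter; apply/eqP; lia.
have sorted_s : sorted geq (Tuple size_s).
  by apply: sort_sorted => a b; rewrite /geq /= leq_total.
have zeros_s : (count (ltn 1) (Tuple size_s) <= count_mem 0%N (Tuple size_s))%N.
  by rewrite /= s2 s0 leq_addl.
exists (NfIndex sorted_s zeros_s); rewrite /nf_labels /= s0 s1 s2 addnK.
rewrite perm_sym; apply: perm_trans (perm_nf_labels t).
rewrite !perm_cat2l (permPl (permEl (perm_sort _ _))).
apply: perm_trans (perm_filter _ sE) _.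
rewrite !filter_cat filter_id; set u := [seq i <- t | ltn 1 i].
have f0 m : [seq i <- nseq m 0%N | ltn 1 i] = [::] by elim: m.
have f1 m : [seq i <- nseq m 1%N | ltn 1 i] = [::] by elim: m.
by rewrite f0 f1 cats0.
Qed.

Lemma map_lsig_unitmx (k : fieldType) n (M : 'M[laurent k]_n) :
  M \in unitmx -> map_mx (@lsig k) M \in unitmx.
Proof.
move=> uM; have MV : map_mx (@lsig k) M *m map_mx (@lsig k) (invmx M) = 1%:M.
  by rewrite -map_mxM mulmxV // map_mx1.
exact: (proj1 (mulmx1_unit MV)).
Qed.

(** * The subgroups $K$ and $H$ in terms of matrices *)

Section GLSubgroups.
Variables (k : fieldType) (n : nat).
Implicit Types g h : GLn k n.
Local Notation O := (pseries k).
Local Notation F := (laurent k).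
Local Notation ps := (map_mx (@psfrac k)).
Local Notation sF := (map_mx (@lsig k)).

Lemma GLmxM g h : GLmx (g * h)%g = GLmx g *m GLmx h.
Proof. by []. Qed.

Lemma GLmxV g : GLmx (g^-1)%g = invmx (GLmx g).
Proof. by []. Qed.

Lemma GLintP g : GLint g <->
  exists (U V : 'M[O]_n), [/\ U *m V = 1%:M, V *m U = 1%:M & GLmx g = ps U].
Proof.
have mxint (M : 'M[F]_n) : (forall i j, laurent_int (M i j)) -> exists U, M = ps U.
  move=> iM; have iM' i j : exists a, M i j = psfrac a by apply/laurent_intP.
  exists (\matrix_(i, j) projT1 (cid (iM' i j))); apply/matrixP => i j.
  by rewrite !mxE; case: cid.
split=> [ig|[U [V [UV VU gU]]]].
  have [U gU] := mxint (GLmx g) (fun i j => (ig i j).1).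
  have [V gV] := mxint (GLmx (g^-1)%g) (fun i j => (ig i j).2).
  have UV : U *m V = 1%:M.
    apply: map_psfrac_inj; rewrite map_mxM map_mx1 -gU -gV.
    by rewrite GLmxV mulmxV // GLmx_unit.
  by exists U, V; split=> //; exact: mulmx1C.
move=> i j; rewrite GLmxV gU; have -> : invmx (ps U) = ps V.
  have uU : ps U \in unitmx by rewrite -gU GLmx_unit.
  by rewrite -[invmx _]mulmx1 -(map_mx1 (@psfrac k)) -UV map_mxM mulKmx.
by rewrite !mxE; split; apply/laurent_intP; eexists.
Qed.

Lemma GLint1 : GLint (1%g : GLn k n).
Proof. by apply/GLintP; exists 1%:M, 1%:M; rewrite mulmx1 map_mx1. Qed.

Lemma GLintM g h : GLint g -> GLint h -> GLint (g * h)%g.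
Proof.
move=> /GLintP[U [V [UV VU gU]]] /GLintP[U' [V' [UV' VU' gU']]].
apply/GLintP; exists (U *m U'), (V' *m V); split.
- by rewrite mulmxA -(mulmxA U) UV' mulmx1.
- by rewrite mulmxA -(mulmxA V') VU mulmx1.
- by rewrite GLmxM gU gU' map_mxM.
Qed.

Lemma GLintV g : GLint g -> GLint (g^-1)%g.
Proof. by move=> ig i j; rewrite invgK; have [] := ig i j. Qed.

(** $\sigma$ commutes with matrix inversion, so a fixed [g] has a fixed inverse. *)
Lemma GLsqP g : (2%:R : k) != 0 -> GLsq g <-> sF (GLmx g) = GLmx g.
Proof.
move=> k2; split=> [sg|sg i j].
  by apply/matrixP => i j; rewrite mxE; apply/(laurent_sqP _ k2); have [] := sg i j.
have sV : sF (GLmx (g^-1)%g) = GLmx (g^-1)%g.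
  by rewrite !GLmxV map_invmx sg.
split; apply/(laurent_sqP _ k2).
  by rewrite -[in RHS]sg mxE.
by rewrite -[in RHS]sV mxE.
Qed.

Lemma GLsqM g h : (2%:R : k) != 0 -> GLsq g -> GLsq h -> GLsq (g * h)%g.
Proof.
move=> k2 /(GLsqP _ k2) sg /(GLsqP _ k2) sh; apply/(GLsqP _ k2).
by rewrite GLmxM map_mxM /= sg sh.
Qed.

Lemma GLsqV g : GLsq g -> GLsq (g^-1)%g.
Proof. by move=> sg i j; rewrite invgK; have [] := sg i j. Qed.

End GLSubgroups.

(** If $TU = \sigma(U)\sigma(x)x^{-1}$ and $T = \sigma(B)B^{-1}$, then $b = B^{-1}Ux$ is fixed by
    $\sigma$, hence in $H$, and $x = U^{-1}Bb$. The cast is the one in the definition of normal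
    forms. *)
Lemma twisted_coset (k : fieldType) (p n : nat) (e : p = n)
    (B T : 'M[laurent k]_p) (x y : GLn k n) :
  (2%:R : k) != 0 -> B \in unitmx -> T *m B = map_mx (@lsig k) B ->
  twisted (map_mx (@lsig k) (GLmx x) *m invmx (GLmx x)) T ->
  GLmx y = castmx (e, e) B ->
  exists a b, [/\ GLint a, GLsq b & x = (a * y * b)%g].
Proof.
move=> k2; case: n / e x y => x y uB TB [U [V [UV VU TU]]]; rewrite castmx_id => yB.
have VU1 : map_mx (@psfrac k) V *m map_mx (@psfrac k) U = 1%:M.
  by rewrite -map_mxM VU map_mx1.
have uV := proj1 (mulmx1_unit VU1).
pose a := MkGLn uV; exists a, (y^-1 * a^-1 * x)%g; split.
- by apply/GLintP; exists V, U.
- apply/(GLsqP _ k2); set b := (_ * x)%g.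
  have bE : B *m GLmx b = map_mx (@psfrac k) U *m GLmx x.
    rewrite -yB -GLmxM /b !mulgA mulgV mul1g GLmxM; congr (_ *m _).
    by rewrite GLmxV -[LHS]mulmx1 -VU1 mulKmx.
  have uB' := map_lsig_unitmx uB.
  apply: (can_inj (mulKmx uB')).
  transitivity (map_mx (@lsig k) (B *m GLmx b)); first exact: (esym (map_mxM _ _ _)).
  rewrite bE map_mxM map_lsig_psfrac -TB -[RHS]mulmxA bE mulmxA TU -!mulmxA.
  by rewrite (mulVmx (GLmx_unit x)) mulmx1.
by rewrite !mulgA mulgK mulgV mul1g.
Qed.

Lemma nf_coset_cover (k : fieldType) (n : nat) (x : GLn k n) :
  (2%:R : k) != 0 -> exists l, nf_coset l x.
Proof.
move=> k2; pose X := GLmx x; have uX : X \in unitmx := GLmx_unit x.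
have sVX : map_mx (@lsig k) (invmx X) *m map_mx (@lsig k) X = 1%:M.
  by rewrite -map_mxM (mulVmx uX) map_mx1.
pose s := map_mx (@lsig k) X *m invmx X.
have ss : map_mx (@lsig k) s *m s = 1%:M.
  rewrite map_mxM map_lsigK /s -mulmxA (mulmxA (map_mx _ (invmx X))) sVX mul1mx.
  exact: mulmxV.
have [t st] := twisted_nf k2 ss.
(* The reductions of [U] and [V] are inverse to each other over $k$, so the sizes agree by rank. *)
have tn : nf_size t = n.
  have [U [V [UV VU _]]] := st.
  have := congr1 (map_mx (@psconst k)) UV; have := congr1 (map_mx (@psconst k)) VU.
  rewrite !map_mxM !map_mx1; move: (map_mx _ U) (map_mx _ V) => U' V' VU' UV'.
  apply/eqP; rewrite eqn_leq -{1}(mxrank1 k (nf_size t)) -{2}(mxrank1 k n) -UV' -VU'.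
  rewrite !(leq_trans (mxrankM_maxl _ _)) ?rank_leq_col ?rank_leq_row //.
have [l tl] := nf_index_of_labels t; rewrite tn in l tl *.
have [a [b [ia sb xE]]] := twisted_coset (y := normal_form k l) k2
  (nf_blockdiag_unit k _) (nf_twistdiagE k _)
  (twisted_trans st (nf_twistdiag_perm k tl)) erefl.
by exists l, a, b.
Qed.

(** * Integration over cosets of K *)

Section Cosets.
Variables (k : fieldType) (n : nat).
Implicit Types a b g h x : GLn k n.
Local Notation O := (pseries k).
Local Notation F := (laurent k).
Local Notation ps := (map_mx (@psfrac k)).

Lemma laurent_nbhs (x : F) m :
  nbhs x [set y | exists c, y = x + lz k ^+ m * psfrac c].
Proof.
apply: open_nbhs_nbhs; split; last by exists 0; rewrite rmorph0 mulr0 addr0.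
move=> y [c ->]; exists m => a /laurent_intP[d ->].
by exists (c + d); rewrite rmorphD mulrDr addrA.
Qed.

Lemma GL_nbhs h m :
  nbhs h [set g : GLn k n | exists E : 'M[O]_n, GLmx g = GLmx h + lz k ^+ m *: ps E].
Proof.
have cGL : continuous (@GLmx k n : GLn k n -> 'M[F]_n) :=
  @initial_continuous _ _ (@GLmx k n).
pose W : set 'M[F]_n := [set M | exists E : 'M[O]_n, M = GLmx h + lz k ^+ m *: ps E].
apply: (cGL h W).
exists (fun i j => [set y | exists c, y = h i j + lz k ^+ m * psfrac c]).
  by move=> i j; exact: laurent_nbhs.
move=> M /= hM; pose c i j := projT1 (cid (hM i j)); exists (\matrix_(i, j) c i j).
by apply/matrixP => i j; rewrite !mxE /c; case: cid.
Qed.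

(** With $V = U^{-1}$, the matrix $V(U + zE)$ is the identity modulo $z$, so its determinant is a
    unit. *)
Lemma GLint_near g h (E : 'M[O]_n) : GLint g ->
  GLmx h = GLmx g + ps (psX k *: E) -> GLint h.
Proof.
move=> /GLintP[U [V [UV VU gU]]]; rewrite gU -map_mxD => hE; apply/GLintP.
set W := U + psX k *: E in hE.
have uW : W \in unitmx.
  have : V *m W \in unitmx.
    rewrite unitmxE psunitE -[psconst _](det_map_mx (@psconst k)).
    have XM m (A : 'M[O]_m) : map_mx (@psconst k) (psX k *: A) = 0.
      by apply/matrixP => i j; rewrite !mxE; exact: (pscoef_psXM _ 0).
    by rewrite mulmxDr VU -scalemxAr map_mxD map_mx1 XM addr0 det1 oner_neq0.
  by rewrite unitmx_mul => /andP[].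
by exists W, (invmx W); rewrite mulmxV ?mulVmx.
Qed.

Lemma GLint_open a b : open [set h : GLn k n | GLint (a * h * b)%g].
Proof.
have [N1 [A aA]] := mx_denom (GLmx a); have [N2 [B bB]] := mx_denom (GLmx b).
(* $z^{N_1}$ and $z^{N_2}$ clear the denominators of [a] and [b]; one more power keeps the
   perturbation divisible by $z$. *)
rewrite openE => h ih; apply: filterS (GL_nbhs h (N1 + N2).+1) => g [E gE].
have ih' : GLint (a * h * b)%g := ih; change (GLint (a * g * b)%g).
apply: (GLint_near (E := A *m E *m B) ih').
rewrite !GLmxM gE mulmxDr mulmxDl; congr (_ + _).
rewrite -scalemxAr -scalemxAl map_mxZ !map_mxM -aA -bB /= psfrac_psX.
by rewrite -!scalemxAl -!scalemxAr !scalerA exprS exprD mulrA.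
Qed.

Definition lcoset a : set (GLn k n) := [set x | GLint (a^-1 * x)%g].
Definition rcoset a : set (GLn k n) := [set x | GLint (x * a^-1)%g].

Lemma lcoset_open a : open (lcoset a).
Proof.
have -> : lcoset a = [set h : GLn k n | GLint (a^-1 * h * 1)%g].
  by apply/seteqP; split=> x /=; rewrite mulg1.
exact: GLint_open.
Qed.

Lemma rcoset_open a : open (rcoset a).
Proof.
have -> : rcoset a = [set h : GLn k n | GLint (1 * h * a^-1)%g].
  by apply/seteqP; split=> x /=; rewrite mul1g.
exact: GLint_open.
Qed.

Lemma lcosetE a : lcoset a = [set (a * x)%g | x in @GLint k n].
Proof.
apply/seteqP; split=> [x ax|_ [x ix <-]]; last by rewrite /lcoset /= mulKg.
by exists (a^-1 * x)%g => //; rewrite mulVKg.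
Qed.

Lemma lcoset_refl a : lcoset a a.
Proof. by rewrite /lcoset /= mulVg; exact: GLint1. Qed.

Lemma rcoset_refl a : rcoset a a.
Proof. by rewrite /rcoset /= mulgV; exact: GLint1. Qed.

Lemma lcoset_eq a b x : lcoset a x -> lcoset b x -> lcoset a = lcoset b.
Proof.
move=> ax bx; have ab : GLint (a^-1 * b)%g.
  have := GLintM ax (GLintV bx); rewrite invgM invgK.
  by rewrite mulgA mulgK.
apply/seteqP; split=> y yy.
  by have := GLintM (GLintV ab) yy; rewrite invgM invgK !mulgA mulgK.
by have := GLintM ab yy; rewrite !mulgA mulgK.
Qed.

(** Serves both the cosets $aK$, for integration, and the cosets $Ka$, for the support of the
    action. *)
Lemma compact_cover_cosets (D : GLn k n -> set (GLn k n)) (S : set (GLn k n)) :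
  (forall a, open (D a)) -> (forall a, D a a) -> compact (closure S) ->
  exists s : seq (GLn k n), forall x, S x -> has (fun a => `[< D a x >]) s.
Proof.
move=> oD DD; rewrite compact_cover => /(_ _ setT D (fun a _ => oD a)).
case=> [x _|s _ Ss]; first by exists x.
exists (finmap.enum_fset s) => x /subset_closure/Ss[a /= sa ax].
by apply/hasP; exists a => //; apply/asboolP.
Qed.

End Cosets.

(** Pieces equal to another one are dropped; distinct pieces being disjoint, a covered point is then
    counted exactly once. *)
Lemma transversal_refine (I T : Type) (P : I -> set T) (s : seq I) :
  (forall i j x, P i x -> P j x -> P i = P j) ->
  exists s' : seq I, forall x,
    count (fun i => `[< P i x >]) s' = has (fun i => `[< P i x >]) s.
Proof.
move=> PP; elim: s => [|i s [s' IHs]]; first by exists [::].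
have [Ps|Ps] := boolP (has (fun j => `[< P j = P i >]) s).
  exists s' => x; rewrite IHs /=; case: asboolP => //= ix.
  suff -> : has (fun j => `[< P j x >]) s = true by []; elim: s Ps {IHs} => //= j s IHs.
  by case: asboolP => [->|_]; case: asboolP => //= _ /IHs.
exists (i :: s') => x; rewrite /= IHs; case: asboolP => //= ix.
suff -> : has (fun i => `[< P i x >]) s = false by [].
apply: contraNF Ps; elim: s {IHs} => //= j s IHs.
case: asboolP => [jx _|_ /IHs ->]; last by rewrite orbT.
by case: asboolP => // H; case: H; exact: PP jx ix.
Qed.

(** A point of the support lies in exactly one piece, where [f] takes its value at the
    representative. The pieces will be cosets $aK$ or double cosets $K\Pi^\lambda H$. *)
Lemma sum_transversal (I T : Type) (V : nmodType) (P : I -> set T) (rep : I -> T)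
    (s : seq I) (f : T -> V) (x : T) :
  (forall i x, P i x -> f x = f (rep i)) ->
  (f x != 0 -> count (fun i => `[< P i x >]) s = 1%N) ->
  f x = \sum_(i <- s) f (rep i) *+ `[< P i x >].
Proof.
move=> fP fs; transitivity (f x *+ count (fun i => `[< P i x >]) s).
  by have [->|/fs ->] := eqVneq (f x) 0; rewrite ?mul0rn.
elim: s {fs} => [|i s IHs] /=; first by rewrite big_nil.
rewrite big_cons mulrnDr IHs; congr (_ + _).
by case: asboolP => // /fP ->.
Qed.

(** * Integrals of right $K$-invariant functions as finite sums *)

Section Integral.
Variables (k : fieldType) (n : nat) (R : realType).
Variable mu : {measure set (GLborel k n) -> \bar R}.
Hypothesis mu_haar : is_haar mu.
Hypothesis mu_K : mu (@GLint k n) = 1%E.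
Local Notation G := (GLn k n).
Implicit Types (a b g x : G) (s : seq G) (f : G -> R[i]).

Lemma GLborel_open (A : set G) : open A -> measurable (A : set (GLborel k n)).
Proof. exact: sub_sigma_algebra. Qed.

Lemma mu_lcoset a : mu (lcoset a) = 1%E.
Proof.
have [_ inv _ _ _] := mu_haar; rewrite lcosetE inv //; apply: GLborel_open.
have -> : @GLint k n = lcoset 1%g; last exact: lcoset_open.
by apply/seteqP; split=> x; rewrite /lcoset /= invg1 mul1g.
Qed.

Lemma measurable_lcoset a : measurable (lcoset a : set (GLborel k n)).
Proof. by apply: GLborel_open; exact: lcoset_open. Qed.

(** By linearity, each coset having measure 1; the cosets may repeat. *)
Lemma integral_lcosets s (r : G -> R) :
  let f x := \sum_(a <- s) r a * \1_(lcoset a) x in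
  mu.-integrable setT (EFin \o f) /\ \int[mu]_x f x = \sum_(a <- s) r a.
Proof.
have int1 a : mu.-integrable setT (EFin \o (\1_(lcoset a) : GLborel k n -> R)).
  have mA := measurable_lcoset a.
  apply/integrableP; split; first by apply/measurable_EFinP; exact: measurable_indic.
  rewrite (eq_integral (fun x : GLborel k n =>
    (\1_(lcoset a : set (GLborel k n)) x)%:E)); last first.
    by move=> t _; rewrite /= indicE normr_nat.
  by rewrite integral_indic // setIT [X in (X < _)%E]mu_lcoset ltry.
elim: s => [|a s [IHi IHv]] /=.
  split.
    apply: eq_integrable (integrable0 mu setT) => // x _ /=.
    by rewrite big_nil.
  rewrite big_nil (eq_Rintegral _ (g := fun=> 0)) => [|x _]; last by rewrite big_nil.
  by rewrite /Rintegral integral0.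
have inta := integrableZl measurableT (r a) (int1 a).
have fE : (fun x : GLborel k n => \sum_(b <- a :: s) r b * \1_(lcoset b) x) =
  (fun x => r a * \1_(lcoset a) x + \sum_(b <- s) r b * \1_(lcoset b) x).
  by apply/funext => x; rewrite big_cons.
rewrite fE; split.
  exact: eq_integrable (integrableD measurableT inta IHi).
rewrite RintegralD // RintegralZl // IHv big_cons; congr (_ + _).
rewrite /Rintegral integral_indic; last exact: measurable_lcoset.
  by rewrite setIT [X in fine X]mu_lcoset mulr1.
exact: measurableT.
Qed.

Definition lcoset_transversal s :=
  forall x, (count (fun a => `[< lcoset a x >]) s <= 1)%N.

Definition lcoset_invariant f := forall x g, GLint g -> f (x * g)%g = f x.

Definition lcoset_support s f :=
  forall x, f x != 0 -> has (fun a => `[< lcoset a x >]) s.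

(** The refined list does not depend on [f], so it can serve two functions at once. *)
Lemma lcoset_refine s : exists s', lcoset_transversal s' /\
  forall f, lcoset_support s f -> lcoset_support s' f.
Proof.
have [s' s'E] := @transversal_refine _ _ (@lcoset k n) s (@lcoset_eq k n).
exists s'; split=> [x|f sf x /sf hs]; first by rewrite s'E leq_b1.
by rewrite has_count s'E hs.
Qed.

Lemma cintegral_lcosets s f :
  lcoset_transversal s -> lcoset_invariant f -> lcoset_support s f ->
  cintegrable mu f /\ cintegral mu f = \sum_(a <- s) f a.
Proof.
move=> ts inv_f sf.
have fE x : f x = \sum_(a <- s) f a *+ `[< lcoset a x >].
  apply: sum_transversal => [a y ay|/sf].
    by rewrite -(inv_f a _ ay) mulVKg.
  by rewrite has_count => hs; apply/eqP; rewrite eqn_leq ts.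
(* [p] stands for the real and the imaginary part. *)
have partE (p : R[i] -> R) (p0 : p 0 = 0) (pD : {morph p : x y / x + y}) x :
    p (f x) = \sum_(a <- s) p (f a) * \1_(lcoset a) x.
  rewrite fE (big_morph p pD p0); apply: eq_bigr => a _; rewrite indicE.
  by case: asboolP => ax; [rewrite mem_set // mulr1 | rewrite memNset // mulr0].
have ReD : {morph @complex.Re R : x y / x + y} by move=> [? ?] [].
have ImD : {morph @complex.Im R : x y / x + y} by move=> [? ?] [].
have [rei rev] := integral_lcosets s (fun a => complex.Re (f a)).
have [imi imv] := integral_lcosets s (fun a => complex.Im (f a)).
split.
  split; [apply: eq_integrable rei | apply: eq_integrable imi] => // x _ /=.
    by rewrite (partE _ erefl ReD).
  by rewrite (partE _ erefl ImD).
rewrite /cintegral.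
rewrite (eq_Rintegral _ (g := fun x : GLborel k n =>
  \sum_(a <- s) complex.Re (f a) * \1_(lcoset a) x)); last first.
  by move=> x _; exact: (partE _ erefl ReD).
rewrite rev (eq_Rintegral _ (g := fun x : GLborel k n =>
  \sum_(a <- s) complex.Im (f a) * \1_(lcoset a) x)); last first.
  by move=> x _; exact: (partE _ erefl ImD).
rewrite imv -(big_morph _ ReD (erefl : complex.Re (0 : R[i]) = 0)).
rewrite -(big_morph _ ImD (erefl : complex.Im (0 : R[i]) = 0)).
by case: (\sum_(a <- s) f a).
Qed.

End Integral.

(** * Linearity and left invariance of the finite sums *)

Section CosetwiseIntegral.
Variables (k : fieldType) (n : nat) (R : realType).
Variable mu : {measure set (GLborel k n) -> \bar R}.
Hypothesis mu_haar : is_haar mu.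
Hypothesis mu_K : mu (@GLint k n) = 1%E.
Local Notation G := (GLn k n).
Implicit Types (a b g x y : G) (s : seq G) (f h : G -> R[i]) (c : R[i]).

(** Such functions factor through a finitely supported function on [G / K]. *)
Definition cosetwise f := lcoset_invariant f /\ exists s, lcoset_support s f.

Lemma cosetwise_transversal f : cosetwise f ->
  exists2 s, lcoset_transversal s & lcoset_support s f.
Proof.
move=> [_ [s sf]]; have [s' [ts' s'P]] := lcoset_refine R s.
by exists s' => //; exact: s'P.
Qed.

Lemma lcoset_support_sub s f h : (forall x, f x = 0 -> h x = 0) ->
  lcoset_support s f -> lcoset_support s h.
Proof. by move=> fh sf x hx; apply: sf; apply: contraNneq hx => /fh ->. Qed.

Lemma cosetwise_mulr f h : lcoset_invariant h -> cosetwise f ->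
  cosetwise (fun y => h y * f y).
Proof.
move=> ih [jf [s sf]]; split=> [x g ig|]; first by rewrite ih ?jf.
by exists s; apply: lcoset_support_sub sf => x ->; rewrite mulr0.
Qed.

Lemma cosetwise_common f h : cosetwise f -> cosetwise h ->
  exists s, [/\ lcoset_transversal s, lcoset_support s f & lcoset_support s h].
Proof.
move=> [_ [s sf]] [_ [t th]]; have [u [tu uP]] := lcoset_refine R (s ++ t).
by exists u; split=> //; apply: uP => x; [move=> /sf | move=> /th];
  rewrite has_cat => ->; rewrite ?orbT.
Qed.

Lemma cosetwise_lin c f h : cosetwise f -> cosetwise h ->
  cosetwise (fun y => c * f y + h y).
Proof.
move=> cf ch; have [s [_ sf sh]] := cosetwise_common cf ch.
split=> [x g ig|]; first by rewrite cf.1 ?ch.1.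
exists s => x; have [f0|/sf //] := eqVneq (f x) 0.
by rewrite f0 mulr0 add0r => /sh.
Qed.

Lemma cintegral_lin c f h : cosetwise f -> cosetwise h ->
  cintegral mu (fun y => c * f y + h y) = c * cintegral mu f + cintegral mu h.
Proof.
move=> cf ch; have [s [ts sf sh]] := cosetwise_common cf ch.
have sfh : lcoset_support s (fun y => c * f y + h y).
  move=> x; have [f0|/sf //] := eqVneq (f x) 0.
  by rewrite f0 mulr0 add0r => /sh.
rewrite (cintegral_lcosets mu_haar mu_K ts _ sf).2 ?(cf.1) //; last exact: cf.1.
rewrite (cintegral_lcosets mu_haar mu_K ts _ sh).2; last exact: ch.1.
rewrite (cintegral_lcosets mu_haar mu_K ts _ sfh).2; last first.
  exact: (cosetwise_lin c cf ch).1.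
by rewrite mulr_sumr -big_split.
Qed.

Lemma cosetwise0 : cosetwise (fun=> 0).
Proof. by split=> //; exists [::] => x; rewrite eqxx. Qed.

Lemma cintegral0 : cintegral mu (fun=> 0) = 0.
Proof.
have ts : @lcoset_transversal k n [::] by [].
have s0 : @lcoset_support k n R [::] (fun=> 0) by move=> x; rewrite eqxx.
by rewrite (cintegral_lcosets mu_haar mu_K ts _ s0).2 ?big_nil.
Qed.

Lemma cintegral_sum (I : Type) (t : seq I) (c : I -> R[i]) (f : I -> G -> R[i]) :
  (forall i, cosetwise (f i)) ->
  cintegral mu (fun y => \sum_(i <- t) c i * f i y) =
    \sum_(i <- t) c i * cintegral mu (f i).
Proof.
move=> cf; have [] : cosetwise (fun y => \sum_(i <- t) c i * f i y) /\
    cintegral mu (fun y => \sum_(i <- t) c i * f i y) =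
    \sum_(i <- t) c i * cintegral mu (f i); last by [].
elim: t => [|i t [cs IHt]].
  have -> : (fun y : G => \sum_(i <- [::]) c i * f i y) = fun=> 0.
    by apply/funext => y; rewrite big_nil.
  by rewrite big_nil cintegral0; split=> //; exact: cosetwise0.
have -> : (fun y : G => \sum_(j <- i :: t) c j * f j y) =
    fun y => c i * f i y + \sum_(j <- t) c j * f j y.
  by apply/funext => y; rewrite big_cons.
by rewrite big_cons cintegral_lin // IHt; split=> //; exact: cosetwise_lin.
Qed.

Lemma cosetwise_mull a f : cosetwise f -> cosetwise (fun y => f (a * y)%g).
Proof.
move=> [jf [s sf]]; split=> [x g ig|]; first by rewrite /= mulgA; exact: jf.
exists [seq (a^-1 * b)%g | b <- s] => x fx; rewrite has_map.
apply: sub_has (sf (a * x)%g fx) => b bx /=.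
by rewrite /lcoset /= invgM invgK -mulgA.
Qed.

(** The cosets of [a^-1 * b] support the translated function when those of [b] support [f], and the
    two sums have the same terms. *)
Lemma cintegral_mull a f : cosetwise f ->
  cintegral mu (fun y => f (a * y)%g) = cintegral mu f.
Proof.
move=> cf; have [s ts sf] := cosetwise_transversal cf.
pose t := [seq (a^-1 * b)%g | b <- s].
have tE x b : lcoset (a^-1 * b)%g x = lcoset b (a * x)%g.
  by rewrite /lcoset /= invgM invgK -mulgA.
have tt : lcoset_transversal t.
  move=> x; rewrite count_map; apply: leq_trans (ts (a * x)%g).
  by apply: sub_count => b /=; rewrite tE.
have sft : lcoset_support t (fun y => f (a * y)%g).
  move=> x fx; rewrite has_map.
  by apply: sub_has (sf (a * x)%g fx) => b bx /=; rewrite tE.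
rewrite (cintegral_lcosets mu_haar mu_K tt _ sft).2; last first.
  exact: (cosetwise_mull a cf).1.
rewrite (cintegral_lcosets mu_haar mu_K ts _ sf).2; last exact: cf.1.
by rewrite big_map; apply: eq_bigr => b _; rewrite mulVKg.
Qed.

End CosetwiseIntegral.

(** * The Hecke module *)

Section HeckeModule.
Variables (k : fieldType) (n : nat) (R : realType).
Hypothesis k2 : (2%:R : k) != 0.
Local Notation G := (GLn k n).
Local Notation C := (R[i]^o).
Implicit Types (a b x y : G) (f g h : G -> C).

Lemma GLsq1 : GLsq (1%g : G).
Proof. by apply/(GLsqP _ k2); rewrite map_mx1. Qed.

Lemma nf_coset_closed (l : nf_index n) a x b :
  GLint a -> GLsq b -> nf_coset l x -> nf_coset l (a * x * b)%g.
Proof.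
move=> ia sb [a' [b' [ia' sb' ->]]]; exists (a * a')%g, (b' * b)%g.
by split; [exact: GLintM | exact: GLsqM | rewrite !mulgA].
Qed.

Lemma nf_coset_eq (l m : nf_index n) x :
  nf_coset l x -> nf_coset m x -> nf_coset (k := k) l = nf_coset m.
Proof.
suff sub l' m' : nf_coset l' x -> nf_coset m' x ->
    nf_coset (k := k) l' `<=` nf_coset m'.
  by move=> lx mx; apply/seteqP; split; exact: sub.
move=> [a [b [ia sb xE]]] mx _ [a' [b' [ia' sb' ->]]].
have -> : (a' * normal_form k l' * b' = (a' * a^-1) * x * (b^-1 * b'))%g.
  by rewrite xE !mulgA mulgVK mulgK.
apply: nf_coset_closed mx; first exact: GLintM ia' (GLintV ia).
exact: GLsqM k2 (GLsqV sb) sb'.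
Qed.

(** Invariance and support are easier to check, for sums and for the action, than an expansion in
    the basis. *)
Lemma hecke_moduleP g : @hecke_module k n R g <->
  (forall a x b, GLint a -> GLsq b -> g (a * x * b)%g = g x) /\
  (exists s : seq (nf_index n),
     forall x, g x != 0 -> has (fun l => `[< nf_coset l x >]) s).
Proof.
split=> [[s [c ->]]|[inv [s sg]]].
  have sE x : (\sum_(l <- s) c l *: @hecke_basis k n R l) x =
      \sum_(l <- s) c l * \1_(nf_coset l) x.
    by elim: s => [|l s IHs]; rewrite ?big_nil // !big_cons -IHs.
  split=> [a x b ia sb|].
    rewrite !sE; apply: eq_bigr => l _; congr (_ * _); rewrite !indicE.
    have -> // : ((a * x * b)%g \in nf_coset l) = (x \in nf_coset l).
    apply/idP/idP; rewrite !inE => lx; last exact: nf_coset_closed.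
    have := nf_coset_closed (GLintV ia) (GLsqV sb) lx.
    by rewrite !mulgA mulVg mul1g mulgK.
  exists s => x; rewrite sE; apply: contraNT => xs; apply/eqP.
  elim: s {sE} xs => [|l s IHs] /=; first by rewrite big_nil.
  rewrite negb_or => /andP[/asboolP lx /IHs]; rewrite big_cons => ->.
  by rewrite indicE memNset // mulr0 addr0.
have [t tE] := @transversal_refine _ _ (@nf_coset k n) s nf_coset_eq.
(* The coefficient of $d_\lambda$ is the value at $\Pi^\lambda$; in the refined list no double coset
   is counted twice. *)
exists t, (fun l => g (normal_form k l)); apply/funext => x.
rewrite (@sum_transversal _ _ _ (@nf_coset k n) (@normal_form k n) t g x).
- elim: t {tE} => [|l t IHt]; rewrite ?big_nil // !big_cons IHt; congr (_ + _).
  by rewrite -mulr_natr; congr (_ * _); rewrite /hecke_basis indicE.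
- move=> l y [a [b [ia sb ->]]]; exact: inv.
- by move=> /sg sx; rewrite tE sx.
Qed.

End HeckeModule.

(** * The action of the Hecke algebra *)

Section HeckeAction.
Variables (k : fieldType) (n : nat) (R : realType).
Hypothesis k2 : (2%:R : k) != 0.
Variable mu : {measure set (GLborel k n) -> \bar R}.
Hypothesis mu_haar : is_haar mu.
Hypothesis mu_K : mu (@GLint k n) = 1%E.
Local Notation G := (GLn k n).
Local Notation C := (R[i]^o).
Implicit Types (a b x y : G) (f g h : G -> C).

Definition GLint_linvariant h := forall a x, GLint a -> h (a * x)%g = h x.

Lemma hecke_module_linvariant g : hecke_module g -> GLint_linvariant g.
Proof.
move=> /(hecke_moduleP k2)[gi _] a x ia.
by have := gi a x 1%g ia (GLsq1 k2); rewrite mulg1.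
Qed.

Lemma hecke_algebra_linvariant f : hecke_algebra f -> GLint_linvariant f.
Proof.
move=> [_ _ fi] a x ia.
by have := fi a x 1%g ia (@GLint1 k n); rewrite mulg1.
Qed.

Lemma hecke_algebra_cosetwise f : hecke_algebra f -> cosetwise f.
Proof.
move=> [_ cf fi]; split=> [x a ia|].
  by have := fi 1%g x a (@GLint1 k n) ia; rewrite mul1g.
have [s sP] := compact_cover_cosets (@lcoset_open k n) (@lcoset_refl k n) cf.
by exists s => x fx; exact: sP.
Qed.

(** Left invariance of [g] makes $y \mapsto g(y^{-1}x)$ right invariant, and [f] bounds the
    support. *)
Lemma cosetwise_act f g x : cosetwise f -> GLint_linvariant g ->
  cosetwise (fun y => g (y^-1 * x)%g * f y).
Proof.
move=> cf gi; apply: (@cosetwise_mulr k n R f (fun y => g (y^-1 * x)%g)) cf => y a ia.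
by rewrite invgM -mulgA (gi _ _ (GLintV ia)).
Qed.

(** Replacing $y$ by $xy$ in the action gives the product, so that associativity becomes a statement
    about the action alone. *)
Lemma hecke_mulE (f1 f2 : G -> C) : cosetwise f1 -> GLint_linvariant f2 ->
  hecke_mul mu f1 f2 = hecke_act mu f1 f2.
Proof.
move=> cf1 if2; apply/funext => x; rewrite /hecke_mul /hecke_act.
rewrite -(cintegral_mull mu_haar mu_K x (cosetwise_act x cf1 if2)).
by congr cintegral; apply/funext => y; rewrite invgM mulgVK mulrC.
Qed.

(** Expanding [f1] over coset representatives $a$ replaces the exchange of two integrals by that of
    a finite sum and one integral; the substitution $y \mapsto a^{-1}y$ moves the translation by $a$
    from [g] to [f2]. *)
Lemma hecke_actA (f1 f2 g : G -> C) :
  cosetwise f1 -> cosetwise f2 -> GLint_linvariant f2 -> GLint_linvariant g ->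
  hecke_act mu (hecke_act mu f1 f2) g = hecke_act mu f1 (hecke_act mu f2 g).
Proof.
move=> cf1 cf2 if2 ig; apply/funext => x.
have [s ts sf1] := cosetwise_transversal cf1.
have actE h y : GLint_linvariant h ->
    hecke_act mu f1 h y = \sum_(a <- s) f1 a * h (a^-1 * y)%g.
  move=> ih; have cy := cosetwise_act y cf1 ih.
  have sy : lcoset_support s (fun a => h (a^-1 * y)%g * f1 a).
    by apply: lcoset_support_sub sf1 => a ->; rewrite mulr0.
  rewrite /hecke_act (cintegral_lcosets mu_haar mu_K ts cy.1 sy).2.
  by apply: eq_bigr => a _; rewrite mulrC.
have cg2 y := cosetwise_act y cf2 ig.
have act_shift a : hecke_act mu f2 g (a^-1 * x)%g =
    cintegral mu (fun y => g (y^-1 * x)%g * f2 (a^-1 * y)%g).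
  rewrite /hecke_act -(cintegral_mull mu_haar mu_K a^-1%g (cg2 _)).
  congr cintegral; apply/funext => y.
  by rewrite invgM invgK mulgA mulgK.
(* The expansion applies to [hecke_act mu f2 g], which is left invariant because [f2] is. *)
rewrite actE; last first.
  move=> a y ia; rewrite /hecke_act -(cintegral_mull mu_haar mu_K a (cg2 _)).
  congr cintegral; apply/funext => w.
  by rewrite if2 // invgM !mulgA mulgVK.
under eq_bigr do rewrite act_shift.
rewrite -(cintegral_sum mu_haar mu_K).
  apply: (congr1 (cintegral mu)); apply/funext => y.
  by rewrite actE // mulr_sumr; apply: eq_bigr => a _; rewrite mulrCA.
move=> a; have := cosetwise_mull a^-1%g (cg2 (a^-1 * x)%g).
congr cosetwise; apply/funext => y.
by rewrite invgM invgK mulgA mulgK.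
Qed.

Lemma hecke_act_module f g : hecke_algebra f -> hecke_module g ->
  hecke_module (hecke_act mu f g).
Proof.
move=> hf hg; have cf := hecke_algebra_cosetwise hf.
have if_ := hecke_algebra_linvariant hf; have ig := hecke_module_linvariant hg.
have /(hecke_moduleP k2)[gi [sg sgP]] := hg.
have [_ cpf _] := hf.
(* Cosets $Kb$ are taken here, so that the factor in $K$ ends up to the left of $b\Pi^\lambda$. *)
have [sf sfP] := compact_cover_cosets (@rcoset_open k n) (@rcoset_refl k n) cpf.
apply/(hecke_moduleP k2); split=> [a x b ia sb|].
  rewrite /hecke_act -(cintegral_mull mu_haar mu_K a (cosetwise_act _ cf ig)).
  congr cintegral; apply/funext => y; rewrite if_ //; congr (_ * _).
  have := gi 1%g (y^-1 * x)%g b (@GLint1 k n) sb; rewrite mul1g => <-.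
  by rewrite invgM !mulgA mulgVK.
have cover b l : exists l', nf_coset l' (b * normal_form k l)%g.
  exact: nf_coset_cover.
pose F l b := projT1 (cid (cover b l)).
exists (flatten [seq [seq F l b | b <- sf] | l <- sg]) => x ax.
have [y] : exists y, g (y^-1 * x)%g * f y != 0.
  apply: contrapT => H; case/eqP: ax; rewrite /hecke_act.
  rewrite -(cintegral0 mu_haar mu_K); congr cintegral; apply/funext => y.
  by apply: contrapT => /eqP yx; apply: H; exists y.
rewrite mulf_eq0 negb_or => /andP[/sgP gy fy].
suff : has (fun l => has (fun b => `[< nf_coset (F l b) x >]) sf) sg.
  elim: (sg) => //= l t IHt; rewrite has_cat has_map => /orP[->//|/IHt ->].
  by rewrite orbT.
apply: sub_has gy => l /asboolP[a [h [ia sh yx]]].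
(* As $y^{-1}x = a\Pi^\lambda h$, the point $ya$ is still in the support of [f], hence in some $Kb$,
   and $x = (yab^{-1})(b\Pi^\lambda)h$. *)
have : f (y * a)%g != 0 by rewrite (cf.1 _ _ ia).
move=> /sfP; apply: sub_has => b /asboolP ab; apply/asboolP.
have -> : x = ((y * a * b^-1) * (b * normal_form k l) * h)%g.
  by rewrite -[x in LHS](mulVKg y) yx !mulgA mulgVK.
by apply: nf_coset_closed => //; exact: projT2 (cid (cover b l)).
Qed.

(** The unit is supported on the single coset $K$, represented by 1. *)
Lemma hecke_act1 g : GLint_linvariant g -> hecke_act mu (@hecke_one k n R) g = g.
Proof.
move=> ig; apply/funext => x; rewrite /hecke_act.
have t1 : @lcoset_transversal k n [:: 1%g] by move=> y /=; rewrite addn0 leq_b1.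
have c1 : lcoset_invariant (@hecke_one k n R).
  move=> y a ia; rewrite /hecke_one !indicE.
  have -> // : ((y * a)%g \in @GLint k n) = (y \in @GLint k n).
  apply/idP/idP => /set_mem iy; apply/mem_set; last exact: GLintM iy ia.
  have := GLintM iy (GLintV ia); rewrite mulgK; exact: id.
have s1 : lcoset_support [:: 1%g] (@hecke_one k n R).
  move=> y; rewrite /hecke_one indicE /= orbF => y1; apply/asboolP.
  rewrite /lcoset /= invg1 mul1g; apply: contrapT => ny.
  by move: y1; rewrite memNset // eqxx.
have c1' : cosetwise (@hecke_one k n R) by split=> //; exists [:: 1%g].
have sx : lcoset_support [:: 1%g] (fun y => g (y^-1 * x)%g * hecke_one R y).
  by apply: lcoset_support_sub s1 => y ->; rewrite mulr0.
rewrite (cintegral_lcosets mu_haar mu_K t1 (cosetwise_act x c1' ig).1 sx).2.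
rewrite big_seq1 invg1 mul1g /hecke_one indicE mem_set ?mulr1 //.
exact: GLint1.
Qed.

End HeckeAction.

Theorem proposition3p1 (k : finFieldType) (hk : 2%N \notin [pchar k])
    (n : nat) (R : realType)
    (mu : {measure set (GLborel k n) -> \bar R})
    (mu_haar : is_haar mu) (mu_K : mu (@GLint k n) = 1%E) :
  (forall f g, @hecke_algebra k n R f -> @hecke_module k n R g ->
     forall x, cintegrable mu (fun y => g (y^-1 * x)%g * f y)) /\
  is_left_module (@hecke_algebra k n R) (hecke_mul mu) (@hecke_one k n R)
    (@hecke_module k n R) (hecke_act mu).
Proof.
have k2 : (2%:R : k) != 0 by apply: contra hk => k20; rewrite inE /= k20.
have cA := @hecke_algebra_cosetwise k n R.
have lA := @hecke_algebra_linvariant k n R.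
have lM := @hecke_module_linvariant k n R k2.
split=> [f g hf hg x|].
  have cx := cosetwise_act x (cA f hf) (lM g hg).
  have [s ts sx] := cosetwise_transversal cx.
  exact: (cintegral_lcosets mu_haar mu_K ts cx.1 sx).1.
split; [split|split].
- by exists [::], (fun=> 0); rewrite big_nil.
(* Two combinations come with different lists and coefficients; in terms of supports it suffices to
   concatenate the lists. *)
- move=> c g h /(hecke_moduleP k2)[gi [s gs]] /(hecke_moduleP k2)[hi [t ht]].
  have E x : (c *: g + h) x = c * g x + h x by [].
  apply/(hecke_moduleP k2); split=> [a x b ia sb|]; first by rewrite !E gi ?hi.
  exists (s ++ t) => x; rewrite E has_cat.
  have [g0|/gs -> //] := eqVneq (g x) 0.
  by rewrite g0 mulr0 add0r => /ht ->; rewrite orbT.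
- by move=> f g; exact: hecke_act_module.
- move=> f c g h hf hg hh; apply/funext => x.
  have cg := cosetwise_act x (cA f hf) (lM g hg).
  have ch := cosetwise_act x (cA f hf) (lM h hh).
  rewrite [RHS]/= -[RHS](cintegral_lin mu_haar mu_K c cg ch); congr cintegral.
  by apply/funext => y; rewrite [LHS]mulrDl -mulrA.
- move=> c f1 f2 g hf1 hf2 hg; apply/funext => x.
  have c1 := cosetwise_act x (cA f1 hf1) (lM g hg).
  have c2 := cosetwise_act x (cA f2 hf2) (lM g hg).
  rewrite -[RHS](cintegral_lin mu_haar mu_K c c1 c2); congr cintegral.
  by apply/funext => y; rewrite [LHS]mulrDr mulrCA.
- move=> f1 f2 g hf1 hf2 hg; rewrite (hecke_mulE mu_haar mu_K (cA _ hf1) (lA _ hf2)).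
  exact: hecke_actA mu_haar mu_K _ _ _ (cA _ hf1) (cA _ hf2) (lA _ hf2) (lM _ hg).
by move=> g hg; exact: hecke_act1 mu_haar mu_K _ (lM _ hg).
Qed.
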